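(* The group of bialgebra automorphisms of ${\cal H}_R$ equals the group of Hopf algebra automorphisms of ${\cal H}_R$, and it decomposes as a semi-direct product $$Aut_{bialgebra}({\cal H}_R)=Aut_{Hopf}({\cal H}_R)=Ker(\chi)\rtimes GL(Prim({\cal H}_R)),$$ where $\chi:Aut_{bialgebra}({\cal H}_R)\to GL(Prim({\cal H}_R))$, $\Phi\mapsto\Phi|_{Prim({\cal H}_R)}$, is the restriction morphism.
   Context: ${\cal H}_R$ is the Connes–Kreimer Hopf algebra of rooted trees over $\mathbb{Q}$: the commutative polynomial algebra on isomorphism classes of rooted trees (finite connected simply connected graphs with a root, edges oriented away from the root), with coproduct the algebra morphism $\Delta(t)=1\otimes t+t\otimes1+\sum_CP^C(t)\otimes R^C(t)$ over admissible cuts $C$ (nonempty edge sets meeting each root-to-vertex path at most once; $R^C(t)$ = component containing the root, $P^C(t)$ = product of the others), counit $\varepsilon(1)=1$, $\varepsilon(t)=0$ on trees, and antipode $S$. $Prim({\cal H}_R)=\{x:\Delta(x)=x\otimes1+1\otimes x\}$, and $GL(Prim({\cal H}_R))$ is the group of linear automorphisms of this vector space. *)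

(* Defs.v *)
From HB Require Import structures.
From mathcomp Require Import all_boot all_algebra finmap.
From mathcomp Require Import monalg.
Set Implicit Arguments. Unset Strict Implicit. Unset Printing Implicit Defensive.
Import GRing.Theory.
Local Open Scope ring_scope.

(* Rooted trees (planar representatives; isomorphism classes below).   *)
Inductive rtree : Type := RNode of seq rtree.

Fixpoint rtree_enc (t : rtree) : GenTree.tree unit :=
  let: RNode ts := t in GenTree.Node 0 (map rtree_enc ts).
Fixpoint rtree_dec (g : GenTree.tree unit) : rtree :=
  match g with
  | GenTree.Leaf _ => RNode [::]
  | GenTree.Node _ gs => RNode (map rtree_dec gs)
  end.
Lemma rtree_encK_ t : rtree_dec (rtree_enc t) = t.
Proof.
move: t; fix IH 1; case=> ts /=; congr RNode.
elim: ts => //= t ts IHts; by rewrite IH IHts.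
Qed.
Lemma rtree_encK : cancel rtree_enc rtree_dec.
Proof. exact: rtree_encK_. Qed.
HB.instance Definition _ := Countable.copy rtree (can_type rtree_encK).

Lemma rtree_ind' (P : rtree -> Prop) :
  (forall ts, (forall u, u \in ts -> P u) -> P (RNode ts)) -> forall t, P t.
Proof.
move=> H.
refine (fix IH t := match t with RNode ts => H ts _ end).
refine ((fix IHl (l : seq rtree) : forall u, u \in l -> P u :=
  match l with
  | [::] => fun u (hu : u \in [::]) => False_ind _ (notF hu)
  | v :: vs => fun u hu => _
  end) ts).
move: hu; rewrite inE; case: eqP => [-> _|_ /= huv]; first exact: (IH v).
exact: (IHl vs u huv).
Qed.

Fixpoint tsize (t : rtree) : nat :=
  let: RNode ts := t in (sumn (map tsize ts)).+1.

(* Canonical form: recursively sort the children (by the injective code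
   [pickle]).  Two planar trees are isomorphic as rooted trees iff they
   have the same canonical form. *)
Definition tle (a b : rtree) : bool := (choice.pickle a <= choice.pickle b)%N.
Fixpoint canon (t : rtree) : rtree :=
  let: RNode ts := t in RNode (sort tle (map canon ts)).

Lemma canon_idem t : canon (canon t) = canon t.
Proof.
elim/rtree_ind': t => ts IH /=; congr RNode.
have -> : map canon (sort tle (map canon ts)) = sort tle (map canon ts).
  rewrite -[RHS]map_id; apply/eq_in_map => u.
  rewrite mem_sort => /mapP [v vin ->]; exact: IH.
apply: sorted_sort; first by move=> a b c; exact: leq_trans.
by apply: sort_sorted => a b; exact: leq_total.
Qed.

(* Isomorphism classes of rooted trees. *)
Definition ctree := {t : rtree | canon t == t}.
Definition cls (t : rtree) : ctree := exist _ (canon t) (introT eqP (canon_idem t)).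

Notation Poly I := {malg rat[{cmonom I}]}.
Definition pvar (I : choiceType) (i : I) : Poly I := mkmalgU (ucm i) 1.
Definition subst (I : choiceType) (S : comAlgType rat) (v : I -> S) (p : Poly I) : S :=
  mmap (fun c : rat => c%:A) (fun m : {cmonom I} => \prod_(i <- finsupp m) v i ^+ m i) p.

Notation HR := (Poly ctree).
(* H_R (x) H_R, realised as Q[trees (+) trees] (x (x) y = x(inl) * y(inr)) *)
Notation HR2 := (Poly (ctree + ctree)%type).

Definition tv (t : rtree) : HR := pvar (cls t).
Definition tens (x y : HR) : HR2 :=
  subst (fun i => pvar (inl i : (ctree + ctree)%type)) x *
  subst (fun i => pvar (inr i : (ctree + ctree)%type)) y.

Definition mleft (m : {cmonom (ctree + ctree)%type}) : HR :=
  \prod_(i <- finsupp m) (if i is inl j then pvar j else 1) ^+ m i.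
Definition mright (m : {cmonom (ctree + ctree)%type}) : HR :=
  \prod_(i <- finsupp m) (if i is inr j then pvar j else 1) ^+ m i.
Definition tensmap (f g : HR -> HR) (z : HR2) : HR2 :=
  \sum_(m <- msupp z) z@_m *: tens (f (mleft m)) (g (mright m)).

(* Admissible cuts.  [cuts t] lists, with multiplicity, all admissible *)
(* cuts of t INCLUDING the empty cut, as pairs (list of pruned trees,  *)
(* trunk R^C(t)); the empty cut gives ([::], t).  For each child c of  *)
(* the root one either cuts the edge above c (c is pruned) or keeps it *)
(* and performs an admissible (possibly empty) cut inside c.           *)
Fixpoint prodseq (A : Type) (ss : seq (seq A)) : seq (seq A) :=
  match ss with
  | [::] => [:: [::]]
  | s :: ss' => [seq x :: y | x <- s, y <- prodseq ss']
  end.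

Fixpoint cuts (t : rtree) : seq (seq rtree * rtree) :=
  let: RNode ts := t in
  [seq (flatten (map fst ch), RNode (pmap snd ch))
  | ch <- prodseq
      (map (fun c => ([:: c], None) :: [seq (p.1, Some p.2) | p <- cuts c]) ts)].

(* coproduct: Delta(t) = t (x) 1 + 1 (x) t + sum_{C nonempty} P^C(t) (x) R^C(t) *)
Definition delta_tree (t : rtree) : HR2 :=
  tens (tv t) 1 + \sum_(pr <- cuts t) tens (\prod_(u <- pr.1) tv u) (tv pr.2).
Definition Delta : HR -> HR2 := subst (fun c : ctree => delta_tree (val c)).

Definition eps (x : HR) : rat := x@_(onecm ctree).

(* antipode: S(t) = - t - sum_{C nonempty} S(P^C(t)) R^C(t), extended
   multiplicatively (recursion on the number of vertices, via fuel) *)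
Fixpoint antip_fuel (n : nat) (t : rtree) : HR :=
  match n with
  | 0 => 0
  | n'.+1 => - tv t - \sum_(pr <- cuts t | pr.1 != [::])
                        (\prod_(u <- pr.1) antip_fuel n' u) * tv pr.2
  end.
Definition antipode : HR -> HR :=
  subst (fun c : ctree => antip_fuel (tsize (val c)) (val c)).

Definition Prim (x : HR) : bool := Delta x == tens x 1 + tens 1 x.

Definition bialg_aut (Phi : HR -> HR) : Prop :=
  [/\ (forall (a : rat) x y, Phi (a *: x + y) = a *: Phi x + Phi y),
      bijective Phi,
      Phi 1 = 1 /\ (forall x y, Phi (x * y) = Phi x * Phi y),
      (forall x, Delta (Phi x) = tensmap Phi Phi (Delta x)) &
      (forall x, eps (Phi x) = eps x)].

Definition hopf_aut (Phi : HR -> HR) : Prop :=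
  bialg_aut Phi /\ (forall x, antipode (Phi x) = Phi (antipode x)).

Definition GLPrim (g : HR -> HR) : Prop :=
  [/\ (forall (a : rat) x y, Prim x -> Prim y -> g (a *: x + y) = a *: g x + g y),
      (forall x, Prim x -> Prim (g x)),
      (forall x y, Prim x -> Prim y -> g x = g y -> x = y) &
      (forall y, Prim y -> exists2 x, Prim x & g x = y)].

Definition ker_chi (Phi : HR -> HR) : Prop :=
  bialg_aut Phi /\ (forall x, Prim x -> Phi x = x).

(* Main.v *)
Require Import Defs.
From HB Require Import structures.
From mathcomp Require Import all_boot all_algebra finmap.
From mathcomp Require Import monalg.
Import Defs.
Set Implicit Arguments. Unset Strict Implicit. Unset Printing Implicit Defensive.
Import GRing.Theory.
Local Open Scope ring_scope.

(** Write [D_x] for the derivation with [D_x (B+ y) = B+ (x y) + B+ (D_x y)]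
(grafting [x] on all vertices), so that [Y = D_1] is the degree.  For a primitive
[p] the operator [L_p x = D_x (Y^-1 p)] satisfies [L_p 1 = p] and
[Delta (L_p x) = L_p x (x) 1 + x1 (x) L_p x2].  These operators show that the
coalgebra is cofree over its primitive elements: [P x = x - sum L_(P x'') x'],
the sum being over the reduced coproduct, is a projection onto them, and a linear
map [h] into them lifts to a unique coalgebra endomorphism.

Composing [P] with [Y^-1 o (S * Y)], which vanishes on products of augmented
elements, gives a projection [pi] onto the primitive elements that kills such
products.  The section sends [g] to the lift of [g o pi]: it is multiplicative
because, by induction on degrees, [Phi (x y) - Phi x Phi y] is a primitive element
with zero image under [pi], and uniqueness of lifts makes it a group morphism.
Finally [S o Phi] and [Phi o S] are both convolution inverses of [Phi]. *)

(** An element of GL(Prim) is an arbitrary linear map: it need not respect the degree, and neither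
    need the automorphism extending it. Hence recursions and inductions about a map only use the
    degree of its argument, never that of its value, and a lift is shown to be bijective by lifting
    the inverse of [g], not by a triangularity argument.

    For p the one-vertex tree, L_p is B+ itself; for the other primitive elements it is a cocycle of
    the same kind starting at p. The factor Y^-1 is a normalisation: L_p 1 is Y applied to Y^-1 p.
    Cofreeness is then the identity x = P x + sum L_(P x'') x' for augmented x, which unfolds x into
    nested operators L applied to primitive elements.

    Two projections are needed because each sees one half of the structure. P suits the coproduct:
    it kills L_p x for augmented x, and so isolates the free primitive summand in the recursion for
    a lift, but it has no reason to kill products. The projection pi kills them and is still the
    identity on primitive elements, so it can fix that summand in a way compatible with
    multiplication. *)

Definition lin (U V : lmodType rat) (f : U -> V) : Prop :=
  forall (a : rat) x y, f (a *: x + y) = a *: f x + f y.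

(** * Linear maps as plain functions *)

Section Lin.
Variables (U V W : lmodType rat).
Implicit Types (f g : U -> V).

Lemma linD f x y : lin f -> f (x + y) = f x + f y.
Proof. by move=> Lf; rewrite -[x]scale1r Lf !scale1r. Qed.

Lemma lin0 f : lin f -> f 0 = 0.
Proof. by move=> Lf; apply: (addrI (f 0)); rewrite -linD // !addr0. Qed.

Lemma linZ f a x : lin f -> f (a *: x) = a *: f x.
Proof. by move=> Lf; rewrite -[a *: x]addr0 Lf lin0 // addr0. Qed.

Lemma linB f x y : lin f -> f (x - y) = f x - f y.
Proof. by move=> Lf; rewrite -scaleN1r addrC Lf scaleN1r addrC. Qed.

Lemma lin_sum f (I : Type) (r : seq I) (P : pred I) (F : I -> U) :
  lin f -> f (\sum_(i <- r | P i) F i) = \sum_(i <- r | P i) f (F i).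
Proof.
by move=> Lf; apply: (big_morph f _ (lin0 Lf)) => x y; exact: linD.
Qed.

Lemma lin_id : lin (fun x : U => x).
Proof. by []. Qed.

Lemma lin_cst0 : lin (fun _ : U => 0 : V).
Proof. by move=> a x y; rewrite scaler0 addr0. Qed.

Lemma lin_add f g : lin f -> lin g -> lin (fun x => f x + g x).
Proof. by move=> Lf Lg a x y; rewrite Lf Lg scalerDr addrACA. Qed.

Lemma lin_sub f g : lin f -> lin g -> lin (fun x => f x - g x).
Proof. by move=> Lf Lg a x y; rewrite Lf Lg scalerBr opprD addrACA. Qed.

Lemma lin_scale c f : lin f -> lin (fun x => c *: f x).
Proof. by move=> Lf a x y; rewrite Lf scalerDr !scalerA mulrC. Qed.

Lemma lin_comp f (h : V -> W) : lin f -> lin h -> lin (fun x => h (f x)).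
Proof. by move=> Lf Lh a x y; rewrite Lf Lh. Qed.

Lemma lin_bigsum (I : Type) (r : seq I) (P : pred I) (F : I -> U -> V) :
  (forall i, lin (F i)) -> lin (fun x => \sum_(i <- r | P i) F i x).
Proof.
move=> LF a x y; rewrite scaler_sumr -big_split /=.
by apply: eq_bigr => i _; rewrite LF.
Qed.
End Lin.

Lemma lin_mull (A : comAlgType rat) (c : A) : lin (fun x : A => c * x).
Proof. by move=> a x y; rewrite mulrDr scalerAr. Qed.

Lemma lin_mulr (A : comAlgType rat) (c : A) : lin (fun x : A => x * c).
Proof. by move=> a x y; rewrite mulrDl scalerAl. Qed.

Definition bilin (U V W : lmodType rat) (B : U -> V -> W) : Prop :=
  (forall v, lin (B^~ v)) /\ (forall u, lin (B u)).

(** * Free modules on monomials and evaluation of polynomials *)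

Section LinExt.
Variables (K : choiceType) (V : lmodType rat).

Definition lext (h : K -> V) (z : {malg rat[K]}) : V :=
  \sum_(m <- msupp z) z@_m *: h m.

Lemma lextEw (h : K -> V) (d : {fset K}) z :
  (msupp z `<=` d)%fset -> lext h z = \sum_(m <- d) z@_m *: h m.
Proof.
move=> le; rewrite /lext (big_fset_incl _ le) //= => m _ /mcoeff_outdom ->.
by rewrite scale0r.
Qed.

Lemma lin_lext (h : K -> V) : lin (lext h).
Proof.
move=> a x y.
pose d := (msupp x `|` msupp y `|` msupp (a *: x + y))%fset.
have sx : (msupp x `<=` d)%fset by rewrite /d -fsetUA fsubsetUl.
have sy : (msupp y `<=` d)%fset by rewrite /d fsetUAC fsubsetUr.
rewrite (lextEw _ sx) (lextEw _ sy) (@lextEw _ d) ?fsubsetUr //.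
rewrite scaler_sumr -big_split /=; apply: eq_bigr => m _.
by rewrite mcoeffD mcoeffZ scalerDl scalerA.
Qed.

Lemma lextU (h : K -> V) c m : lext h << c *g m >> = c *: h m.
Proof. by rewrite (lextEw _ msuppU_le) big_seq_fset1 mcoeffUU. Qed.

Lemma malg_expand (z : {malg rat[K]}) :
  z = \sum_(m <- msupp z) z@_m *: << m >>.
Proof.
rewrite {1}[z]monalgE; apply: eq_bigr => m _.
by apply/malgP => k; rewrite mcoeffZ !mcoeffU mulrnAr mulr1.
Qed.

Lemma lextE (f : {malg rat[K]} -> V) z :
  lin f -> f z = lext (fun m => f << m >>) z.
Proof.
move=> Lf; rewrite {1}[z]malg_expand lin_sum //.
by apply: eq_bigr => m _; rewrite linZ.
Qed.

Lemma malg_ext (f g : {malg rat[K]} -> V) :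
  lin f -> lin g -> (forall m, f << m >> = g << m >>) -> f =1 g.
Proof.
move=> Lf Lg E x; rewrite (lextE x Lf) (lextE x Lg).
by apply: eq_bigr => m _; rewrite E.
Qed.

Lemma eq_lext (h k : K -> V) z :
  {in msupp z, h =1 k} -> lext h z = lext k z.
Proof.
move=> E; rewrite /lext !big_seq; apply: eq_bigr => m /E -> //.
Qed.
End LinExt.

Section MonomialEval.
Variables (I : choiceType) (S : comNzRingType) (v : I -> S).

Definition monev (m : {cmonom I}) : S := \prod_(i <- finsupp m) v i ^+ m i.

Lemma monevEw (d : {fset I}) (m : {cmonom I}) :
  (finsupp m `<=` d)%fset -> monev m = \prod_(i <- d) v i ^+ m i.
Proof.
move=> le; rewrite /monev (big_fset_incl _ le) //= => i _.
by rewrite -cmE_eq0 => /eqP ->.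
Qed.

Lemma monev_mmorphism : mmorphism monev.
Proof.
split=> [m1 m2|]; last by rewrite /monev mdom1 big_seq_fset0.
rewrite {1}/monev mdomD.
rewrite (monevEw (fsubsetUl _ (finsupp m2))) (monevEw (fsubsetUr (finsupp m1) _)).
by rewrite -big_split /=; apply: eq_bigr => i _; rewrite cmM exprD.
Qed.

HB.instance Definition _ := isMultiplicative.Build {cmonom I} S monev
  monev_mmorphism.

Lemma monev1 : monev (onecm I) = 1.
Proof. exact: (mmorph1 monev). Qed.

Lemma monevM m1 m2 : monev (mulcm m1 m2) = monev m1 * monev m2.
Proof. exact: (mmorphM monev). Qed.

Lemma monevU i : monev (ucm i) = v i.
Proof. by rewrite /monev mdomU big_seq_fset1 cmUU expr1. Qed.
End MonomialEval.

Lemma cmonom_ind (I : choiceType) (P : {cmonom I} -> Prop) :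
  P (onecm I) -> (forall i m, P m -> P (mulcm (ucm i) m)) -> forall m, P m.
Proof.
move=> P1 PM m; move: {2}(mdeg m) (erefl (mdeg m)) => n.
elim: n m => [|n IH] m dm; first by rewrite (mdeg_eq0I dm).
have [i im]: exists i, i \in finsupp m.
  have: finsupp m != fset0.
    by apply/eqP => E; move: dm; rewrite mdegE E big_seq_fset0.
  by case/fset0Pn => i im; exists i.
have E : m = mulcm (ucm i) (divcm m (ucm i)).
  apply/eqP/cmP => j; rewrite mulcmE divcmE !ucmE.
  case: eqP => [<-|_]; last by rewrite add0n subn0.
  by rewrite subnKC // lt0n cmE_neq0.
rewrite E; apply: PM; apply: IH; move: dm; rewrite {1}E.
by rewrite mdegM mdegU add1n => -[].
Qed.

Section Poly.
Variable (I : choiceType).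
Implicit Types (x y : Poly I).

Lemma monoM (m1 m2 : {cmonom I}) :
  << mulcm m1 m2 >> = << m1 >> * << m2 >> :> Poly I.
Proof. by rewrite malgM_def fgmulUU mulr1. Qed.

Lemma mono_monev (m : {cmonom I}) : << m >> = monev (@pvar I) m :> Poly I.
Proof.
by elim/cmonom_ind: m => [|i m IH]; rewrite ?monev1 // monevM monevU monoM IH.
Qed.

Lemma Poly_ind (P : Poly I -> Prop) :
  P 1 -> (forall a x y, P x -> P y -> P (a *: x + y)) ->
  (forall i x, P x -> P (pvar i * x)) -> forall x, P x.
Proof.
move=> P1 PL PM x.
have P0 : P 0 by have := PL (-1) 1 1 P1 P1; rewrite scaleN1r addNr.
rewrite [x]malg_expand.
elim: (enum_fset (msupp x)) => [|m r IH]; first (rewrite big_nil; exact: P0).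
rewrite big_cons; apply: PL; last exact: IH.
elim/cmonom_ind: m => [|i m IHm]; first exact: P1.
by rewrite monoM; apply: PM; exact: IHm.
Qed.

Section Subst.
Variables (S : comAlgType rat) (v : I -> S).

Lemma substE x : subst v x = mmap (in_alg S) (monev v) x.
Proof. by []. Qed.

Lemma lin_subst : lin (subst v).
Proof.
move=> a x y; rewrite !substE mmapD mmapZ.
by rewrite /= mulr_algl.
Qed.

Lemma subst1 : subst v 1 = 1.
Proof. by rewrite substE mmap1. Qed.

Lemma substM x y : subst v (x * y) = subst v x * subst v y.
Proof. exact: (mmap_is_multiplicative (f := in_alg S) (h := monev v)).1. Qed.

Lemma subst_var i : subst v (pvar i) = v i.
Proof. by rewrite substE /pvar mmapU /= scale1r mul1r monevU. Qed.

Lemma subst_mono m : subst v << m >> = monev v m.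
Proof. by rewrite substE mmapU /= scale1r mul1r. Qed.

End Subst.

Lemma eq_subst (S : comAlgType rat) (v w : I -> S) : v =1 w -> subst v =1 subst w.
Proof.
move=> E; elim/Poly_ind => [|a x y Hx Hy|i x Hx]; first by rewrite !subst1.
  by rewrite !lin_subst Hx Hy.
by rewrite !substM Hx !subst_var E.
Qed.
End Poly.

Lemma coef1M (R : comNzRingType) (p q : {poly R}) :
  (p * q)`_1 = p`_1 * q`_0 + p`_0 * q`_1.
Proof. by rewrite coefM 2!big_ord_recl big_ord0 /= addr0 addrC. Qed.

Lemma derivation_eigen (A : comAlgType rat) (d : A -> A) (n k : nat) x y :
  d (x * y) = d x * y + x * d y -> d x = n%:R *: x -> d y = k%:R *: y ->
  d (x * y) = (n + k)%:R *: (x * y).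
Proof. by move=> -> -> ->; rewrite -scalerAl -scalerAr -scalerDl natrD. Qed.

Lemma eigen_sum (V : lmodType rat) (n k : nat) (v : V) :
  n%:R *: v + k%:R *: v = (n + k)%:R *: v.
Proof. by rewrite -scalerDl natrD. Qed.

(* [H2] is a tensor square of [H]: each [z : H2] is given as a finite sum of pure
   tensors, linearly enough for [tsum_lin] to hold even when [B] is not bilinear. *)
Record tensor (H H2 : comAlgType rat) := Tensor {
  tens : H -> H -> H2;
  tidx : Type;
  tsupp : H2 -> seq tidx;
  tcoef : H2 -> tidx -> rat;
  tleft : tidx -> H;
  tright : tidx -> H;
  tens_bilin : bilin tens;
  tensM : forall x y x' y', tens x y * tens x' y' = tens (x * x') (y * y');
  tens11 : tens 1 1 = 1;
  tens_span : forall z,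
    \sum_(m <- tsupp z) tcoef z m *: tens (tleft m) (tright m) = z;
  tsum_lin : forall (V : lmodType rat) (B : H -> H -> V),
    lin (fun z => \sum_(m <- tsupp z) tcoef z m *: B (tleft m) (tright m));
  tsum_tens : forall (V : lmodType rat) (B : H -> H -> V) x y, bilin B ->
    \sum_(m <- tsupp (tens x y)) tcoef (tens x y) m *: B (tleft m) (tright m) = B x y
}.

(** * Sweedler sums over a tensor square *)

Section Tensor.
Variables (H H2 : comAlgType rat) (T : tensor H H2).
Implicit Types (x y : H) (z : H2).
Local Notation tens := (tens T).

Lemma lin_tensl y : lin (tens^~ y).
Proof. exact: (tens_bilin T).1. Qed.

Lemma lin_tensr x : lin (tens x).
Proof. exact: (tens_bilin T).2. Qed.

Section Bil.
Variable V : lmodType rat.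
Implicit Types B C : H -> H -> V.

(** Sweedler notation: [bil B (Delta x)] is the sum of B(x1, x2). It is linear in [z] for every [B];
    bilinearity of [B] is what makes its value at [tens x y] independent of the decomposition chosen
    there. *)
Definition bil B z : V :=
  \sum_(m <- tsupp T z) tcoef z m *: B (tleft m) (tright m).

Lemma lin_bil B : lin (bil B).
Proof. exact: tsum_lin. Qed.

Lemma bil_tens B x y : bilin B -> bil B (tens x y) = B x y.
Proof. exact: tsum_tens. Qed.

Lemma eq_bil B C z : (forall x y, B x y = C x y) -> bil B z = bil C z.
Proof. by move=> E; apply: eq_bigr => m _; rewrite E. Qed.

Lemma bil0 z : bil (fun _ _ => 0) z = 0.
Proof. by rewrite /bil big1 // => m _; rewrite scaler0. Qed.

Lemma bil_add B C z : bil (fun x y => B x y + C x y) z = bil B z + bil C z.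
Proof.
by rewrite /bil -big_split /=; apply: eq_bigr => m _; rewrite scalerDr.
Qed.

Lemma bil_sub B C z : bil (fun x y => B x y - C x y) z = bil B z - bil C z.
Proof. by rewrite /bil -sumrB; apply: eq_bigr => m _; rewrite scalerBr. Qed.

Lemma lin_bil_fun (U : lmodType rat) (B : U -> H -> H -> V) z :
  (forall x y, lin (fun u => B u x y)) -> lin (fun u => bil (B u) z).
Proof. by move=> LB; apply: lin_bigsum => m; apply: lin_scale. Qed.
End Bil.

Lemma lin_of_bil (U V : lmodType rat) (f : U -> V) (B : H -> H -> U) z :
  lin f -> f (bil B z) = bil (fun x y => f (B x y)) z.
Proof.
by move=> Lf; rewrite lin_sum //; apply: eq_bigr => m _; rewrite linZ.
Qed.

Lemma bil_tensE z : bil tens z = z.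
Proof. exact: tens_span. Qed.

Lemma lin_eq_bil (V : lmodType rat) (f : H2 -> V) z :
  lin f -> f z = bil (fun x y => f (tens x y)) z.
Proof. by move=> Lf; rewrite -lin_of_bil // bil_tensE. Qed.

Lemma bil_exchange (V : lmodType rat) (B : H -> H -> H -> H -> V) z z' :
  bil (fun x y => bil (B x y) z') z =
  bil (fun x' y' => bil (fun x y => B x y x' y') z) z'.
Proof.
rewrite /bil; under eq_bigr do rewrite scaler_sumr.
rewrite exchange_big; apply: eq_bigr => m _.
rewrite scaler_sumr; apply: eq_bigr => n _.
by rewrite !scalerA mulrC.
Qed.

Lemma bilM (V : lmodType rat) (B : H -> H -> V) z z' : bilin B ->
  bil B (z * z') = bil (fun x y => bil (fun x' y' => B (x * x') (y * y')) z') z.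
Proof.
move=> bB.
rewrite (lin_eq_bil z (lin_comp (lin_mulr z') (lin_bil B))).
apply: eq_bil => x y.
rewrite (lin_eq_bil z' (lin_comp (lin_mull (tens x y)) (lin_bil B))).
by apply: eq_bil => x' y'; rewrite tensM bil_tens.
Qed.

Lemma bil_one (V : lmodType rat) (B : H -> H -> V) : bilin B -> bil B 1 = B 1 1.
Proof. by move=> bB; rewrite -(tens11 T) bil_tens. Qed.

(** Multiplicativity of [f] and commutativity regroup f(a a') (b b') as (f(a) b) (f(a') b'), and
    each factor sums to a scalar. An identity such as S * id = eps therefore has to be checked on
    generators only. *)
Lemma convol_mul (f : H -> H) (c c' : rat) z z' :
  lin f -> (forall x y, f (x * y) = f x * f y) ->
  bil (fun a b => f a * b) z = c *: 1 -> bil (fun a b => f a * b) z' = c' *: 1 ->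
  bil (fun a b => f a * b) (z * z') = (c * c') *: 1.
Proof.
move=> Lf fM Ez Ez'; have bf : bilin (fun a b => f a * b).
  by split=> [b|a]; [exact: lin_comp Lf (lin_mulr b)|exact: lin_mull].
rewrite bilM //.
transitivity (bil (fun a b => f a * b * (c' *: 1)) z).
  apply: eq_bil => a b; rewrite -Ez' (lin_of_bil _ _ (lin_mull _)).
  by apply: eq_bil => a' b'; rewrite fM mulrACA.
by rewrite -(lin_of_bil _ _ (lin_mulr _)) Ez -scalerAl mul1r scalerA.
Qed.
End Tensor.

Arguments lin_bil {H H2} T {V} B.
Arguments lin_of_bil {H H2} T {U V f} B z.
Arguments bil_exchange {H H2} T {V} B z z'.

Create HintDb linear.

Ltac linear_leaf :=
  first
    [ assumption
    | lazymatch goal with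
      | |- lin (tens _ _) => exact: lin_tensr
      | |- lin (fun y => tens _ y _) => exact: lin_tensl
      | |- lin ( *%R _) => exact: lin_mull
      | |- lin (fun y => y * _) => exact: lin_mulr
      | |- lin (bil _ _) => exact: lin_bil
      end
    | match goal with
      | H : bilin ?B |- lin (?B ?u) => exact (proj2 H u)
      | H : bilin ?B |- lin (fun y => ?B y ?c) => exact (proj1 H c)
      | H : forall _, lin _ |- _ => exact (H _)
      | H : forall _ _, lin _ |- _ => exact (H _ _)
      | H : forall (_ : lmodType rat) _, lin _ |- _ => exact (H _ _)
      end
    | solve [auto with linear nocore] ].

Ltac linear_app k :=
  first
    [ linear_leaf
    | lazymatch goal with
      | |- lin (fun x => ?h (@?f x)) =>
          refine (@lin_comp _ _ _ f h _ _); [k tt | linear_leaf]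
      end
    | lazymatch goal with
      | |- lin (fun x => ?h (@?f x) ?c) =>
          refine (@lin_comp _ _ _ f (fun y => h y c) _ _); [k tt | linear_leaf]
      end
    | lazymatch goal with
      | |- lin (fun x => ?h (@?f x) ?c ?d) =>
          refine (@lin_comp _ _ _ f (fun y => h y c d) _ _); [k tt | linear_leaf]
      end ].

(** Peels the goal by its head symbol. A part independent of the variable is still matched as a
    function of it; [c 0], [B 0] and [z 0] recover the constant. When the dependence is real,
    unification fails and the next alternative is tried. *)
Ltac linear_tac :=
  intros; cbv beta;
  lazymatch goal with
  | |- bilin _ => split; linear_tac
  | |- lin (fun x => x) => exact: lin_id
  | |- lin (fun x => 0) => exact: lin_cst0
  | |- lin (fun x => @?f x - @?g x) =>
      refine (@lin_sub _ _ f g _ _); linear_tac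
  | |- lin (fun x => @?f x + @?g x) =>
      refine (@lin_add _ _ f g _ _); linear_tac
  | |- lin (fun x => @?c x *: @?f x) =>
      first
        [ refine (@lin_scale _ _ (c 0) f _)
        | lazymatch c with fun x => ?e (@?g x) =>
            lazymatch f with fun _ => ?v =>
              refine (@lin_comp _ _ _ g (fun y => e y *: v) _ _); [|linear_leaf]
            end
          end ]; linear_tac
  | |- lin (fun x => bil ?T (@?B x) (@?z x)) =>
      first
        [ refine (@lin_bil_fun _ _ T _ _ B (z 0) _)
        | refine (@lin_comp _ _ _ z (bil T (B 0)) _ _) ]; linear_tac
  | |- _ => linear_app ltac:(fun _ => linear_tac)
  end.

(** * Cofree graded bialgebras *)

(* Unification on [{malg rat[_]}] unfolds products of polynomials when it fails, so
   the theory is stated over abstract algebras and instantiated afterwards. *)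
Section Cofree.
Variables (H H2 : comAlgType rat) (T : tensor H H2).
Variables (Delta : H -> H2) (eps : H -> rat) (Bp : H -> H) (D : H -> H -> H).
Local Notation tens := (tens T).
Local Notation bil := (bil T).

Hypothesis Delta_lin : lin Delta.
Hypothesis Delta1 : Delta 1 = 1.
Hypothesis DeltaM : forall x y, Delta (x * y) = Delta x * Delta y.
Hypothesis eps_lin : forall (V : lmodType rat) (v : V), lin (fun x => eps x *: v).
Hypothesis eps1 : eps 1 = 1.
Hypothesis epsM : forall x y, eps (x * y) = eps x * eps y.
Hypothesis Bp_lin : lin Bp.
Hypothesis eps_Bp : forall x, eps (Bp x) = 0.
Hypothesis Delta_Bp : forall x,
  Delta (Bp x) = tens (Bp x) 1 + bil (fun a b => tens a (Bp b)) (Delta x).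
Hypothesis H_ind : forall P : H -> Prop,
  (forall a x y, P x -> P y -> P (a *: x + y)) -> P 1 ->
  (forall x y, P x -> P y -> P (x * y)) -> (forall x, P x -> P (Bp x)) ->
  forall x, P x.
Hypothesis D_lin : forall x, lin (D x).
Hypothesis DM : forall x y z, D x (y * z) = D x y * z + y * D x z.
Hypothesis D_Bp : forall x y, D x (Bp y) = Bp (x * y) + Bp (D x y).

(** * Counit and coassociativity *)

Lemma epsD x y : eps (x + y) = eps x + eps y.
Proof.
have := linD x y (eps_lin (1 : rat^o)).
by rewrite -scalerDl /GRing.scale /= !mulr1.
Qed.

Lemma epsZ a x : eps (a *: x) = a * eps x.
Proof.
have := linZ a x (eps_lin (1 : rat^o)).
by rewrite scalerA /GRing.scale /= !mulr1.
Qed.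

Lemma epsB x y : eps (x - y) = eps x - eps y.
Proof. by rewrite epsD -scaleN1r epsZ mulN1r. Qed.

Lemma eps0 : eps 0 = 0.
Proof. by rewrite -(subrr 0) epsB subrr. Qed.

Lemma lin_eps_ext (V : lmodType rat) (f g : H -> V) x :
  (forall x, eps x = 0 -> f x = g x) -> f 1 = g 1 -> lin f -> lin g -> f x = g x.
Proof.
move=> E E1 Lf Lg; rewrite -[x](subrK (eps x *: 1)) (linD _ _ Lf) (linD _ _ Lg).
rewrite (linZ _ _ Lf) (linZ _ _ Lg) E1.
by congr (_ + _); apply: E; rewrite epsB epsZ eps1 mulr1 subrr.
Qed.

Lemma Delta1E : Delta 1 = tens 1 1.
Proof. by rewrite Delta1 tens11. Qed.

(** The coalgebra axioms are consequences of the cocycle equation [Delta_Bp]: [H] is generated from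
    1 by linear combinations, products and [Bp], and that equation reduces the case of [Bp x] to
    [x]. *)
Lemma counitl x : bil (fun a b => eps a *: b) (Delta x) = x.
Proof.
elim/H_ind: x => [c x y Hx Hy||x y Hx Hy|x Hx].
- by rewrite Delta_lin lin_bil Hx Hy.
- by rewrite Delta1E bil_tens ?eps1 ?scale1r //; linear_tac.
- rewrite DeltaM bilM; last by linear_tac.
  rewrite -{2}Hx (lin_of_bil _ _ _ (lin_mulr y)); apply: eq_bil => a b.
  rewrite -{2}Hy (lin_of_bil _ _ _ (lin_mull _)); apply: eq_bil => a' b'.
  by rewrite epsM -scalerAl -scalerAr scalerA.
- rewrite Delta_Bp linD; last exact: lin_bil.
  rewrite bil_tens; last by linear_tac.
  rewrite eps_Bp scale0r add0r (lin_of_bil _ _ _ (lin_bil _ _)).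
  rewrite -{2}Hx (lin_of_bil _ _ _ Bp_lin); apply: eq_bil => a b.
  by rewrite bil_tens ?linZ //; linear_tac.
Qed.

Lemma counitr x : bil (fun a b => eps b *: a) (Delta x) = x.
Proof.
elim/H_ind: x => [c x y Hx Hy||x y Hx Hy|x Hx].
- by rewrite Delta_lin lin_bil Hx Hy.
- by rewrite Delta1E bil_tens ?eps1 ?scale1r //; linear_tac.
- rewrite DeltaM bilM; last by linear_tac.
  rewrite -{2}Hx (lin_of_bil _ _ _ (lin_mulr y)); apply: eq_bil => a b.
  rewrite -{2}Hy (lin_of_bil _ _ _ (lin_mull _)); apply: eq_bil => a' b'.
  by rewrite epsM -scalerAl -scalerAr scalerA.
- rewrite Delta_Bp linD; last exact: lin_bil.
  rewrite bil_tens; last by linear_tac.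
  rewrite eps1 scale1r (lin_of_bil _ _ _ (lin_bil _ _)).
  rewrite -[RHS]addr0; congr (_ + _); rewrite -[RHS](bil0 T _ (Delta x)).
  apply: eq_bil => a b; rewrite bil_tens; last by linear_tac.
  by rewrite eps_Bp scale0r.
Qed.

Definition trilin (V : lmodType rat) (t : H -> H -> H -> V) : Prop :=
  [/\ forall b c, lin (fun a => t a b c), forall a c, lin (fun b => t a b c)
    & forall a b, lin (t a b)].

(* Testing against trilinear maps avoids introducing a triple tensor product. *)
Lemma coassoc (V : lmodType rat) (t : H -> H -> H -> V) x : trilin t ->
  bil (fun a c => bil (fun a1 a2 => t a1 a2 c) (Delta a)) (Delta x) =
  bil (fun a c => bil (fun c1 c2 => t a c1 c2) (Delta c)) (Delta x).
Proof.
elim/H_ind: x V t => [c x y Hx Hy||x y Hx Hy|x Hx] V t tt; case: (tt) => t1 t2 t3.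
- by rewrite Delta_lin !lin_bil Hx // Hy.
- rewrite Delta1E !bil_tens; try by linear_tac.
  by rewrite Delta1E !bil_tens //; linear_tac.
- rewrite DeltaM !bilM; try by linear_tac.
  transitivity (bil (fun a c => bil (fun a1 a2 =>
      bil (fun a' c' => bil (fun a1' a2' => t (a1 * a1') (a2 * a2') (c * c')) (Delta a'))
         (Delta y)) (Delta a)) (Delta x)).
    apply: eq_bil => a c; rewrite bil_exchange; apply: eq_bil => a' c'.
    by rewrite DeltaM bilM //; linear_tac.
  rewrite Hx; last by split; linear_tac.
  apply: eq_bil => a c.
  transitivity (bil (fun c1 c2 => bil (fun a' c' => bil (fun c1' c2' =>
     t (a * a') (c1 * c1') (c2 * c2')) (Delta c')) (Delta y)) (Delta c)).
    by apply: eq_bil => c1 c2; rewrite Hy //; split; linear_tac.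
  rewrite bil_exchange; apply: eq_bil => a' c'.
  by rewrite DeltaM bilM //; linear_tac.
- rewrite !Delta_Bp !linD; try exact: lin_bil.
  rewrite !bil_tens; try by linear_tac.
  rewrite Delta_Bp Delta1E linD; last exact: lin_bil.
  rewrite !bil_tens; try by linear_tac.
  rewrite -!addrA; congr (_ + _).
  rewrite !(lin_of_bil _ _ _ (lin_bil _ _)).
  transitivity (bil (fun a c => t a (Bp c) 1) (Delta x) +
     bil (fun a c => bil (fun a1 a2 => t a1 a2 (Bp c)) (Delta a)) (Delta x)).
    by congr (_ + _); apply: eq_bil => a b; rewrite bil_tens //; linear_tac.
  rewrite Hx; last by split; linear_tac.
  rewrite -bil_add; apply: eq_bil => a b.
  rewrite bil_tens; last by linear_tac.
  rewrite Delta_Bp linD; last exact: lin_bil.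
  rewrite bil_tens; last by linear_tac.
  rewrite (lin_of_bil _ _ _ (lin_bil _ _)); congr (_ + _).
  by apply: eq_bil => c1 c2; rewrite bil_tens //; linear_tac.
Qed.

(** * The derivations [D x] and their coproduct *)

Lemma D1 x : D x 1 = 0.
Proof.
have := DM x 1 1; rewrite !mul1r mulr1 => /eqP.
by rewrite -subr_eq subrr => /eqP.
Qed.

(** The grafted element enters only through the summand [Bp (x * y)] of [D_Bp], which is linear in
    it; induction on [y] spreads this over [H]. *)
Lemma D_linl y : lin (fun x => D x y).
Proof.
elim/H_ind: y => [c y z Hy Hz||y z Hy Hz|y Hy] a x x'.
- by rewrite !D_lin Hy Hz scalerDr addrACA !scalerDr !scalerA [c * a]mulrC.
- by rewrite !D1 scaler0 addr0.
- by rewrite !DM Hy Hz mulrDl mulrDr addrACA -scalerAl -scalerAr -scalerDr.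
- by rewrite !D_Bp Hy mulrDl -scalerAl !Bp_lin addrACA -scalerDr.
Qed.

Lemma eps_D x y : eps (D x y) = 0.
Proof.
elim/H_ind: y => [c y z Hy Hz||y z Hy Hz|y Hy].
- by rewrite D_lin epsD epsZ Hy Hz mulr0 addr0.
- by rewrite D1 eps0.
- by rewrite DM epsD !epsM Hy Hz mul0r mulr0 addr0.
- by rewrite D_Bp epsD !eps_Bp addr0.
Qed.

(** Combinatorially, [x] is grafted on a vertex of [y] and the result is cut. If that vertex is
    pruned, all of [x] is pruned with it, which gives [tens (D x y1) y2]. If it stays in the trunk,
    [x] is itself cut into a pruned part [x1] and a part [x2] still grafted on the trunk. *)
Lemma Delta_D x y : Delta (D x y) =
  bil (fun y1 y2 => bil (fun x1 x2 => tens (y1 * x1) (D x2 y2)) (Delta x)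
                    + tens (D x y1) y2) (Delta y).
Proof.
have Dl := D_linl.
elim/H_ind: y => [c y z Hy Hz||y z Hy Hz|y Hy].
- by rewrite D_lin !Delta_lin lin_bil Hy Hz.
- rewrite D1 Delta1E bil_tens; last by linear_tac.
  rewrite (lin0 Delta_lin) D1 (lin0 (lin_tensl T 1)) addr0.
  rewrite -[LHS](bil0 T _ (Delta x)); apply: eq_bil => a b.
  by rewrite D1 (lin0 (lin_tensr T _)).
- rewrite DM linD // !DeltaM bilM; last by linear_tac.
  rewrite Hy Hz (lin_of_bil _ _ _ (lin_mulr _)).
  rewrite -{2}[Delta y](bil_tensE T) (lin_of_bil _ _ _ (lin_mulr _)) -bil_add.
  apply: eq_bil => y1 y2.
  rewrite -{1}[Delta z](bil_tensE T) !(lin_of_bil _ _ _ (lin_mull _)) -bil_add.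
  apply: eq_bil => z1 z2; rewrite mulrDl mulrDr !tensM DM.
  rewrite (lin_of_bil _ _ _ (lin_mulr _)) (lin_of_bil _ _ _ (lin_mull _)).
  rewrite addrACA -bil_add (linD _ _ (lin_tensl T _)); congr (_ + _).
  apply: eq_bil => x1 x2; rewrite !tensM DM (linD _ _ (lin_tensr T _)).
  by congr (tens _ _ + tens _ _); rewrite ?mulrA // mulrAC.
- rewrite D_Bp linD // !Delta_Bp DeltaM Hy [Delta x * _]mulrC bilM; last by linear_tac.
  rewrite [in RHS]linD; last exact: lin_bil.
  rewrite bil_tens; last by linear_tac.
  have -> : bil (fun x1 x2 => tens (Bp y * x1) (D x2 1)) (Delta x) = 0.
    rewrite -[RHS](bil0 T _ (Delta x)); apply: eq_bil => a b.
    by rewrite D1 (lin0 (lin_tensr T _)).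
  rewrite add0r D_Bp (linD _ _ (lin_tensl T _)) addrACA; congr (_ + _).
  rewrite !(lin_of_bil _ _ _ (lin_bil _ _)) -bil_add.
  apply: eq_bil => y1 y2; rewrite bil_tens; last by linear_tac.
  rewrite linD; last exact: lin_bil.
  rewrite bil_tens; last by linear_tac.
  rewrite addrA; congr (_ + _).
  rewrite (lin_of_bil _ _ _ (lin_bil _ _)) -bil_add; apply: eq_bil => x1 x2.
  rewrite bil_tens; last by linear_tac.
  by rewrite D_Bp (linD _ _ (lin_tensr T _)) [x2 * _]mulrC.
Qed.

#[local] Hint Resolve D_linl : linear.

(** * Primitive elements and the reduced coproduct *)

Definition primitive (x : H) : Prop := Delta x = tens x 1 + tens 1 x.

Definition rho (x : H) : H := x - eps x *: 1.

Lemma lin_rho : lin rho.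
Proof. by rewrite /rho; linear_tac. Qed.
#[local] Hint Resolve lin_rho : linear.

Lemma rho1 : rho 1 = 0.
Proof. by rewrite /rho eps1 scale1r subrr. Qed.

Lemma eps_rho x : eps (rho x) = 0.
Proof. by rewrite /rho epsB epsZ eps1 mulr1 subrr. Qed.

Lemma rho_id x : eps x = 0 -> rho x = x.
Proof. by rewrite /rho => ->; rewrite scale0r subr0. Qed.

Section Reduced.
Variable V : lmodType rat.
Implicit Types B C : H -> H -> V.

(* [B] summed over the reduced coproduct: [rho] removes the terms in [x (x) 1]
   and [1 (x) x]. *)
Definition red B x : V := bil (fun a b => B (rho a) (rho b)) (Delta x).

Lemma lin_red B : lin (red B).
Proof. by rewrite /red; linear_tac. Qed.

Lemma eq_red B C x :
  (forall a b, eps a = 0 -> eps b = 0 -> B a b = C a b) -> red B x = red C x.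
Proof. by move=> E; apply: eq_bil => a b; apply: E; exact: eps_rho. Qed.

Lemma red_add B C x : red (fun a b => B a b + C a b) x = red B x + red C x.
Proof. exact: bil_add. Qed.

Lemma red_sub B C x : red (fun a b => B a b - C a b) x = red B x - red C x.
Proof. exact: bil_sub. Qed.

Lemma red0 x : red (fun _ _ => 0 : V) x = 0.
Proof. exact: bil0. Qed.

Lemma red_prim B p : bilin B -> primitive p -> red B p = 0.
Proof.
move=> bB Pp; rewrite /red Pp linD; last exact: lin_bil.
rewrite !bil_tens; try by linear_tac.
by rewrite rho1 (lin0 (bB.1 _)) (lin0 (bB.2 _)) addr0.
Qed.

Lemma red1 B : bilin B -> red B 1 = 0.
Proof.
move=> bB; rewrite /red Delta1E bil_tens; last by linear_tac.
by rewrite rho1 (lin0 (bB.1 _)).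
Qed.

Lemma red_rho B x : bilin B -> red B (rho x) = red B x.
Proof.
move=> bB; rewrite /rho (linB _ _ (lin_red B)) (linZ _ _ (lin_red B)) red1 //.
by rewrite scaler0 subr0.
Qed.

(** Inclusion-exclusion: expanding B(rho a, rho b) by bilinearity gives four sums, and the counit
    identities evaluate the three that contain a counit. The component along 1 (x) 1 is counted in
    both [B x 1] and [B 1 x], hence the subtraction. *)
Lemma bil_red B x : bilin B ->
  bil B (Delta x) = red B x + B x 1 + B 1 x - eps x *: B 1 1.
Proof.
move=> bB; have [bl br] := bB.
have -> : B x 1 = bil (fun a b => eps b *: B a 1) (Delta x).
  rewrite -{1}[x]counitr (lin_of_bil _ _ _ (bl 1)).
  by apply: eq_bil => a b; rewrite (linZ _ _ (bl 1)).
have -> : B 1 x = bil (fun a b => eps a *: B 1 b) (Delta x).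
  rewrite -{1}[x]counitl (lin_of_bil _ _ _ (br 1)).
  by apply: eq_bil => a b; rewrite (linZ _ _ (br 1)).
have -> : eps x *: B 1 1 = bil (fun a b => eps a *: (eps b *: B 1 1)) (Delta x).
  rewrite -{1}[x]counitl; rewrite -[eps _ *: _](scale1r).
  have -> : forall u, 1 *: (eps u *: B 1 1) = (fun w => eps w *: B 1 1) u.
    by move=> u; rewrite scale1r.
  rewrite (lin_of_bil _ _ _ (eps_lin (B 1 1))).
  by apply: eq_bil => a b; rewrite epsZ scalerA.
rewrite /red -!bil_add -bil_sub; apply: eq_bil => a b.
rewrite /rho (linB _ _ (bl _)) !(linB _ _ (br _)) !(linZ _ _ (bl _)) !(linZ _ _ (br _)).
by rewrite -scalerBr [X in X + _ - _]addrAC subrK -addrA -scalerBr subrK.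
Qed.
End Reduced.

Lemma lin_of_red (U V : lmodType rat) (f : U -> V) (B : H -> H -> U) x :
  lin f -> f (red B x) = red (fun a b => f (B a b)) x.
Proof. exact: lin_of_bil. Qed.

Lemma red_coassoc (V : lmodType rat) (t : H -> H -> H -> V) x : trilin t ->
  red (fun a c => red (fun a1 a2 => t a1 a2 c) a) x =
  red (fun a c => red (fun c1 c2 => t a c1 c2) c) x.
Proof.
move=> [t1 t2 t3].
transitivity (bil (fun a c => bil (fun a1 a2 => t (rho a1) (rho a2) (rho c))
  (Delta a)) (Delta x)).
  by apply: eq_bil => a b; rewrite red_rho //; linear_tac.
rewrite coassoc; last by split; linear_tac.
by apply: eq_bil => a b; rewrite red_rho //; linear_tac.
Qed.

Lemma primitiveP x : primitive x <-> eps x = 0 /\ red tens x = 0.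
Proof.
have E := bil_red x (tens_bilin T); rewrite bil_tensE in E; split=> [Px|[ex rx]].
  have ex : eps x = 0.
    (* Contracting the left leg of x (x) 1 + 1 (x) x with the counit gives x = eps(x) 1 + x. *)
    have := counitl x; rewrite Px linD; last exact: lin_bil.
    rewrite !bil_tens; try by linear_tac.
    rewrite eps1 scale1r => /(congr1 (fun u => u - x)); rewrite addrK subrr => ex0.
    have := congr1 eps ex0; rewrite eps0 epsZ eps1 mulr1 => <- //.
  split=> //; have := congr1 (fun u => u - (tens x 1 + tens 1 x)) E.
  by rewrite Px ex scale0r subr0 -[_ + _ + tens 1 x]addrA subrr addrK.
by rewrite /primitive E ex rx scale0r subr0 add0r.
Qed.

Lemma primitive_eps p : primitive p -> eps p = 0.
Proof. by case/primitiveP. Qed.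

Lemma primitive_lin a x y : primitive x -> primitive y -> primitive (a *: x + y).
Proof.
rewrite /primitive Delta_lin (lin_tensl T) (lin_tensr T) => -> ->.
by rewrite scalerDr addrACA.
Qed.

Lemma primitive0 : primitive 0.
Proof.
by rewrite /primitive (lin0 Delta_lin) (lin0 (lin_tensl T _)) (lin0 (lin_tensr T _)) addr0.
Qed.

Lemma primitiveB x y : primitive x -> primitive y -> primitive (x - y).
Proof. by move=> Px Py; rewrite addrC -scaleN1r; exact: primitive_lin. Qed.

(** * Inverse of the degree and the operators L_p *)

Variable Yinv : H -> H.
Hypothesis Yinv_lin : lin Yinv.
Hypothesis D1_Yinv : forall x, D 1 (Yinv x) = rho x.
Hypothesis Yinv_D1 : forall x, Yinv (D 1 x) = rho x.
Hypothesis D1_tens_inj : forall z,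
  bil (fun a b => tens (D 1 a) b + tens a (D 1 b)) z = 0 -> exists c : rat, z = c *: 1.

Lemma Delta_D1 x :
  Delta (D 1 x) = bil (fun a b => tens (D 1 a) b + tens a (D 1 b)) (Delta x).
Proof.
rewrite Delta_D; apply: eq_bil => a b.
by rewrite Delta1E bil_tens ?mulr1 1?addrC //; linear_tac.
Qed.

(** By [Delta_D1] the degree is a coderivation, so the defect [z] of primitivity of [q] is killed by
    Y (x) id + id (x) Y and is therefore a scalar; contracting its left leg with the counit shows
    that this scalar is 0. *)
Lemma primitive_Yinv p : primitive p -> primitive (Yinv p).
Proof.
move=> Pp; have ep := primitive_eps Pp; set q := Yinv p.
have Yq : D 1 q = p by rewrite D1_Yinv rho_id.
pose B := fun a b => tens (D 1 a) b + tens a (D 1 b).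
have bB : bilin B by rewrite /B; linear_tac.
pose z := Delta q - (tens q 1 + tens 1 q).
have [c Ec] : exists c : rat, z = c *: 1.
  apply: D1_tens_inj; rewrite (linB _ _ (lin_bil T B)) -Delta_D1 Yq.
  rewrite (linD _ _ (lin_bil T B)) !bil_tens // /B Yq D1 Pp.
  by rewrite (lin0 (lin_tensl T _)) (lin0 (lin_tensr T _)) addr0 add0r subrr.
(* [Yinv p = Yinv (D 1 (Yinv p)) = rho (Yinv p)] is augmented. *)
have eq0 : eps q = 0.
  by rewrite -[q]/(Yinv p) -{1}[p](rho_id ep) -D1_Yinv Yinv_D1 eps_rho.
have Ez : bil (fun a b => eps a *: b) z = 0.
  rewrite linB; last exact: lin_bil.
  rewrite counitl linD; last exact: lin_bil.
  rewrite !bil_tens; try by linear_tac.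
  by rewrite eps1 scale1r eq0 scale0r add0r subrr.
have Ez' : bil (fun a b => eps a *: b) z = c *: 1.
  rewrite Ec linZ; last exact: lin_bil.
  by rewrite -(tens11 T) bil_tens ?eps1 ?scale1r //; linear_tac.
have c0 : c = 0.
  by have := congr1 eps Ez'; rewrite Ez eps0 epsZ eps1 mulr1.
by move/eqP: Ec; rewrite c0 scale0r subr_eq0 => /eqP.
Qed.

Definition ladder (p x : H) : H := D x (Yinv p).
Local Notation L := ladder.

Lemma lin_ladderl x : lin (fun p => L p x).
Proof. by rewrite /ladder; linear_tac. Qed.

Lemma lin_ladderr p : lin (L p).
Proof. by rewrite /ladder; linear_tac. Qed.
#[local] Hint Resolve lin_ladderl lin_ladderr : linear.

Lemma ladder1 p : primitive p -> L p 1 = p.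
Proof. by move=> /primitive_eps ep; rewrite /ladder D1_Yinv rho_id. Qed.

Lemma eps_ladder p x : eps (L p x) = 0.
Proof. exact: eps_D. Qed.

(** In [Delta_D] for the primitive element [Yinv p], the leg 1 meets a derivation in two of the four
    terms, and derivations vanish at 1. The two surviving terms are those of the statement. *)
Lemma Delta_ladder p x : primitive p ->
  Delta (L p x) = tens (L p x) 1 + bil (fun a b => tens a (L p b)) (Delta x).
Proof.
move=> Pp; rewrite /ladder Delta_D primitive_Yinv // linD; last exact: lin_bil.
rewrite !bil_tens; try by linear_tac.
have -> : bil (fun x1 x2 => tens (Yinv p * x1) (D x2 1)) (Delta x) = 0.
  rewrite -[RHS](bil0 T _ (Delta x)); apply: eq_bil => a b.
  by rewrite D1 (lin0 (lin_tensr T _)).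
rewrite D1 (lin0 (lin_tensl T _)) addr0 add0r; congr (_ + _).
by apply: eq_bil => a b; rewrite mul1r.
Qed.

(** In the sum of x1 (x) L_p x2, the component of x2 along 1 contributes x (x) L_p 1 = x (x) p; what
    remains is a sum over the reduced coproduct. *)
Lemma red_ladder (V : lmodType rat) (B : H -> H -> V) p x :
  bilin B -> primitive p ->
  red B (L p x) = B (rho x) p + red (fun a b => B a (L p b)) x.
Proof.
move=> bB Pp; have [bl br] := bB.
rewrite {1}/red Delta_ladder // linD; last exact: lin_bil.
rewrite bil_tens; last by linear_tac.
rewrite rho1 (lin0 (br _)) add0r (lin_of_bil _ _ _ (lin_bil _ _)).
have -> : B (rho x) p = bil (fun a b => eps b *: B (rho a) p) (Delta x).
  have Lf : lin (fun a => B (rho a) p) by linear_tac.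
  rewrite -{1}[x]counitr (lin_of_bil _ _ _ Lf).
  by apply: eq_bil => a b; rewrite (linZ _ _ Lf).
rewrite -bil_add; apply: eq_bil => a b; rewrite bil_tens; last by linear_tac.
rewrite (rho_id (eps_ladder p b)) [rho b]/rho (linB _ _ (lin_ladderr p)).
by rewrite (linZ _ _ (lin_ladderr p)) ladder1 // (linB _ _ (br _)) (linZ _ _ (br _)) addrC subrK.
Qed.

(** * Recursion along the degree filtration *)

Variables (F : nat -> H -> Prop) (deg : H -> nat).
Hypothesis F_deg : forall x, F (deg x) x.
(** The reduced coproduct of an element of [F n] has both legs in lower filtration. Legs are visible
    only through sums [red], hence the form of a congruence. *)
Hypothesis red_congr : forall (V : lmodType rat) (B C : H -> H -> V) n x,
  bilin B -> bilin C -> F n x ->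
  (forall k l a b, (k < n)%N -> (l < n)%N -> F k a -> F l b ->
     eps a = 0 -> eps b = 0 -> B a b = C a b) ->
  red B x = red C x.

Lemma F_ind (P : H -> Prop) :
  (forall n x, F n x -> (forall k y, (k < n)%N -> F k y -> P y) -> P x) ->
  forall x, P x.
Proof.
move=> HP x; move: (deg x) (F_deg x) => d; elim/ltn_ind: d x => n IH x Fx.
by apply: HP Fx _ => k y kn Fy; exact: IH kn y Fy.
Qed.

Section FiltrationFixpoint.
Variable G : (H -> H) -> H -> H.
Hypothesis G_lin : forall f, lin f -> lin (G f).
Hypothesis G_congr : forall n f g x, lin f -> lin g -> F n x ->
  (forall k y, (k < n)%N -> F k y -> f y = g y) -> G f x = G g x.

Let approx n : H -> H := iter n G (fun _ => 0).

(** On [F n] the map [G f] depends on [f] only strictly below [n], so iterating [G] from any start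
    is stationary there after n + 1 rounds. This replaces a structural recursion, since the
    recursive calls sit on the legs of a coproduct. *)
Definition lfix (x : H) : H := approx (deg x).+1 x.

Let approx_lin n : lin (approx n).
Proof. by elim: n => [|n IH]; [exact: lin_cst0|exact: G_lin]. Qed.

Let approx_stable n x N : F n x -> (n < N)%N -> approx N x = approx n.+1 x.
Proof.
elim/ltn_ind: n x N => n IH x [//|N] Fx nN.
apply: (G_congr (approx_lin N) (approx_lin n) Fx) => k y kn Fy.
by rewrite (IH k kn y N) ?(IH k kn y n) // (leq_trans kn).
Qed.

Let lfix_approx n x N : F n x -> (n < N)%N -> lfix x = approx N x.
Proof.
move=> Fx nN; rewrite /lfix -(approx_stable (F_deg x) (leq_maxl (deg x).+1 N)).
by rewrite (approx_stable Fx (leq_trans nN (leq_maxr _ _))) -(approx_stable Fx nN).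
Qed.

Lemma lfix_lin : lin lfix.
Proof.
(* The number of iterations depends on the argument; a common bound [N] brings the three values to
   one and the same linear approximation. *)
move=> a x y; pose N := (maxn (deg (a *: x + y)) (maxn (deg x) (deg y))).+1.
rewrite !(lfix_approx (N := N) (F_deg _)) ?approx_lin //.
- by rewrite ltnS leq_max leq_max leqnn !orbT.
- by rewrite ltnS leq_max leq_max leqnn !orbT.
- by rewrite ltnS leq_max leqnn.
Qed.

Lemma lfixE x : lfix x = G lfix x.
Proof.
rewrite {1}/lfix; apply: (G_congr (approx_lin _) lfix_lin (F_deg x)) => k y kx Fy.
by rewrite (lfix_approx Fy kx).
Qed.
End FiltrationFixpoint.

(** * The projection onto primitive elements adapted to the coproduct *)

Definition primproj_step (f : H -> H) (x : H) : H :=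
  rho x - red (fun a b => L (f b) a) x.
Definition primproj : H -> H := lfix primproj_step.

Lemma primproj_step_lin f : lin f -> lin (primproj_step f).
Proof. by move=> Lf; apply: lin_sub; [exact: lin_rho|exact: lin_red]. Qed.

Lemma primproj_step_congr n f g x : lin f -> lin g -> F n x ->
  (forall k y, (k < n)%N -> F k y -> f y = g y) ->
  primproj_step f x = primproj_step g x.
Proof.
move=> Lf Lg Fx E; congr (_ - _); apply: red_congr Fx _; try by linear_tac.
by move=> k l a b _ ln _ Fb _ _; rewrite (E l).
Qed.

Lemma lin_primproj : lin primproj.
Proof. exact: lfix_lin primproj_step_lin primproj_step_congr. Qed.
#[local] Hint Resolve lin_primproj : linear.

Lemma primprojE x : primproj x = rho x - red (fun a b => L (primproj b) a) x.
Proof. exact: (lfixE primproj_step_lin primproj_step_congr). Qed.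

Lemma eps_red (B : H -> H -> H) x :
  (forall a b, eps (B a b) = 0) -> eps (red B x) = 0.
Proof.
move=> E; suff: eps (red B x) *: (1 : H) = 0.
  by move/(congr1 eps); rewrite epsZ eps1 mulr1 eps0.
rewrite (lin_of_red _ _ (eps_lin (1 : H))) -[RHS](red0 H x).
by apply: eq_red => a b _ _; rewrite E scale0r.
Qed.

(** By induction [red_ladder] applies to each L_(P x'') x', and the sum has reduced coproduct x' (x)
    P x'' plus x' (x) L_(P x''') x''. Coassociativity gathers the right legs into P x'' + sum L_(P
    (x'')'') (x'')' = x'', and x' (x) x'' cancels the reduced coproduct of x. *)
Lemma primitive_primproj x : primitive (primproj x).
Proof.
elim/F_ind: x => n x Fx IH; rewrite primprojE; apply/primitiveP; split.
  by rewrite epsB eps_rho eps_red ?subrr // => a b; exact: eps_ladder.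
have bL : bilin (fun a b => L (primproj b) a) by linear_tac.
rewrite (linB _ _ (lin_red tens)) (red_rho _ (tens_bilin T)).
rewrite (lin_of_red _ _ (lin_red tens)).
pose t a b c := tens a (L (primproj c) b).
have -> : red (fun a b => red tens (L (primproj b) a)) x =
    red (fun a b => tens a (primproj b) + red (fun a1 a2 => t a1 a2 b) a) x.
  apply: (red_congr (n := n)) => // [||k l a b kn ln Fa Fb ea eb].
  - by rewrite /red; linear_tac.
  - by rewrite /red /t; linear_tac.
  - by rewrite red_ladder ?rho_id //; [exact: tens_bilin|exact: IH ln Fb].
rewrite red_add red_coassoc; last by split; rewrite /t; linear_tac.
rewrite -red_add -red_sub -[RHS](red0 H2 x); apply: eq_red => a b _ eb.
rewrite -(lin_of_red (fun c1 c2 => L (primproj c2) c1) b (lin_tensr T a)).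
rewrite -(linD _ _ (lin_tensr T a)) {1}primprojE subrK rho_id //.
exact: subrr.
Qed.

Lemma primproj_id p : primitive p -> primproj p = p.
Proof.
move=> Pp; rewrite primprojE red_prim ?rho_id ?subr0 ?primitive_eps //.
by linear_tac.
Qed.

(** [red_ladder] splits the sum that defines P (L_p x): its leading term L_(P p) x = L_p x cancels
    L_p x, and the other terms vanish by induction. *)
Lemma primproj_ladder p x : primitive p -> eps x = 0 -> primproj (L p x) = 0.
Proof.
elim/F_ind: x p => n x Fx IH p Pp ex.
rewrite primprojE rho_id ?eps_ladder // red_ladder //; last by linear_tac.
rewrite (rho_id ex) (primproj_id Pp).
have -> : red (fun a b => L (primproj (L p b)) a) x = red (fun _ _ => 0) x.
  apply: (red_congr (n := n)) => //; try by linear_tac.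
  move=> k l a b kn ln Fa Fb ea eb.
  by rewrite (IH l) // (lin0 (lin_ladderl a)).
by rewrite red0 addr0 subrr.
Qed.

(** * The projection onto primitive elements killing products *)

Variable S : H -> H.
Hypothesis S_lin : lin S.
Hypothesis S1 : S 1 = 1.
Hypothesis SM : forall x y, S (x * y) = S x * S y.
Hypothesis S_convol : forall x, bil (fun a b => S a * b) (Delta x) = eps x *: 1.

(* [S * Y]: an [eps]-derivation, hence zero on products of augmented elements. *)
Definition dynkin (x : H) : H := bil (fun a b => S a * D 1 b) (Delta x).

Lemma lin_dynkin : lin dynkin.
Proof. by rewrite /dynkin; linear_tac. Qed.
#[local] Hint Resolve lin_dynkin : linear.

(** The Leibniz rule gives two sums. In each of them one of the two factors is not differentiated,
    and it collapses to its counit by S * id = eps. *)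
Lemma dynkinM x y : dynkin (x * y) = eps y *: dynkin x + eps x *: dynkin y.
Proof.
rewrite /dynkin DeltaM bilM; last by linear_tac.
have Ex : eps y *: bil (fun a b => S a * D 1 b) (Delta x) =
    bil (fun a b => bil (fun a' b' => (S a * D 1 b) * (S a' * b')) (Delta y)) (Delta x).
  rewrite (lin_of_bil _ _ _ (lin_scale _ (@lin_id H))); apply: eq_bil => a b.
  by rewrite -(lin_of_bil _ _ _ (lin_mull _)) S_convol -scalerAr mulr1.
have Ey : eps x *: bil (fun a b => S a * D 1 b) (Delta y) =
    bil (fun a b => bil (fun a' b' => (S a * b) * (S a' * D 1 b')) (Delta y)) (Delta x).
  rewrite bil_exchange (lin_of_bil _ _ _ (lin_scale _ (@lin_id H))); apply: eq_bil => a b.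
  by rewrite -(lin_of_bil _ _ _ (lin_mulr _)) S_convol -scalerAl mul1r.
rewrite Ex Ey -bil_add; apply: eq_bil => a b; rewrite -bil_add; apply: eq_bil => a' b'.
by rewrite SM DM mulrDr !mulrA [_ * _ * D 1 b]mulrAC [_ * S a' * b]mulrAC.
Qed.

(** On a primitive p, S * Y equals Y p, which [Yinv] undoes. In a cocommutative bialgebra the values
    of S * Y would already be primitive; this fails here, hence the outer [primproj]. *)
Definition indecproj (x : H) : H := primproj (Yinv (dynkin x)).

Lemma lin_indecproj : lin indecproj.
Proof. by rewrite /indecproj; linear_tac. Qed.
#[local] Hint Resolve lin_indecproj : linear.

Lemma primitive_indecproj x : primitive (indecproj x).
Proof. exact: primitive_primproj. Qed.

Lemma indecproj_id p : primitive p -> indecproj p = p.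
Proof.
move=> Pp; rewrite /indecproj /dynkin Pp linD; last exact: lin_bil.
rewrite !bil_tens; try by linear_tac.
by rewrite D1 mulr0 add0r S1 mul1r Yinv_D1 rho_id ?primproj_id ?primitive_eps.
Qed.

Lemma dynkin1 : dynkin 1 = 0.
Proof. by rewrite /dynkin Delta1E bil_tens ?D1 ?mulr0 //; linear_tac. Qed.

Lemma indecproj1 : indecproj 1 = 0.
Proof. by rewrite /indecproj dynkin1 (lin0 Yinv_lin) (lin0 lin_primproj). Qed.

Lemma indecprojM x y : eps x = 0 -> eps y = 0 -> indecproj (x * y) = 0.
Proof.
move=> ex ey; rewrite /indecproj dynkinM ex ey !scale0r addr0.
by rewrite (lin0 Yinv_lin) (lin0 lin_primproj).
Qed.

(** * Coalgebra endomorphisms and lifts *)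

Definition coalg (f : H -> H) : Prop :=
  [/\ lin f, f 1 = 1, forall x, eps (f x) = eps x
    & forall (V : lmodType rat) (B : H -> H -> V) x, bilin B ->
        red B (f x) = red (fun a b => B (f a) (f b)) x].

Lemma coalg_Delta f x : coalg f ->
  Delta (f x) = bil (fun a b => tens (f a) (f b)) (Delta x).
Proof.
move=> [Lf f1 ef rf]; have bf : bilin (fun a b => tens (f a) (f b)) by linear_tac.
by rewrite -[LHS](bil_tensE T) (bil_red _ (tens_bilin T)) (bil_red _ bf)
  (rf _ _ _ (tens_bilin T)) f1 ef.
Qed.

(** If [f] and [g] agree below the degree of an augmented x, then f x and g x have the same reduced
    coproduct and differ by a primitive element. It is fixed by [indecproj], which by assumption
    sends it to 0. *)
Lemma coalg_inj f g : coalg f -> coalg g ->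
  (forall x, indecproj (f x) = indecproj (g x)) -> f =1 g.
Proof.
move=> [Lf f1 ef rf] [Lg g1 eg rg] E.
suff H0 x : eps x = 0 -> f x = g x.
  by move=> x; apply: lin_eps_ext => //; rewrite f1 g1.
elim/F_ind: x => n x Fx IH ex.
have Pd : primitive (f x - g x).
  apply/primitiveP; split; first by rewrite epsB ef eg subrr.
  rewrite (linB _ _ (lin_red tens)) rf ?rg; try exact: tens_bilin.
  rewrite -red_sub -[RHS](red0 H2 x).
  apply: (red_congr (n := n)) => //; try by linear_tac.
  move=> k l a b kn ln Fa Fb ea eb.
  by rewrite (IH k a) // (IH l b) // subrr.
apply/eqP; rewrite -subr_eq0 -(indecproj_id Pd) (linB _ _ lin_indecproj) E subrr.
by [].
Qed.

Section Lift.
Variable h : H -> H.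
Hypothesis h_lin : lin h.
Hypothesis h_prim : forall x, primitive (h x).
Hypothesis h1 : h 1 = 0.

(* A coalgebra map [f] satisfies [f x = P (f x) + lift_rest f x] for augmented [x],
   and [P (f x)] is forced by the condition [pi (f x) = h x]. *)
Definition lift_rest (f : H -> H) (x : H) : H :=
  red (fun a b => L (primproj (f b)) (f a)) x.

Definition lift_step (f : H -> H) (x : H) : H :=
  eps x *: 1 + (h x - indecproj (lift_rest f x)) + lift_rest f x.

Definition lift : H -> H := lfix lift_step.

Lemma lift_rest_bilin (f : H -> H) : lin f -> bilin (fun a b => L (primproj (f b)) (f a)).
Proof. by linear_tac. Qed.

Lemma lin_lift_rest (f : H -> H) : lin (lift_rest f).
Proof. exact: lin_red. Qed.
#[local] Hint Resolve lin_lift_rest : linear.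

Lemma lift_step_lin (f : H -> H) : lin f -> lin (lift_step f).
Proof. by rewrite /lift_step; linear_tac. Qed.

Lemma lift_step_congr n f g x : lin f -> lin g -> F n x ->
  (forall k y, (k < n)%N -> F k y -> f y = g y) -> lift_step f x = lift_step g x.
Proof.
move=> Lf Lg Fx E; rewrite /lift_step; suff -> : lift_rest f x = lift_rest g x by [].
apply: red_congr Fx _; try exact: lift_rest_bilin.
by move=> k l a b kn ln Fa Fb _ _; rewrite (E k a) // (E l b).
Qed.

Lemma lift_lin : lin lift.
Proof. exact: lfix_lin lift_step_lin lift_step_congr. Qed.
#[local] Hint Resolve lift_lin : linear.

Lemma liftE x : lift x = eps x *: 1 + (h x - indecproj (lift_rest lift x))
                         + lift_rest lift x.
Proof. exact: (lfixE lift_step_lin lift_step_congr). Qed.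

Lemma eps_lift_rest f x : eps (lift_rest f x) = 0.
Proof. by apply: eps_red => a b; exact: eps_ladder. Qed.

Lemma eps_lift x : eps (lift x) = eps x.
Proof.
rewrite liftE 2!epsD epsB eps_lift_rest epsZ eps1 mulr1.
by rewrite (primitive_eps (h_prim x)) (primitive_eps (primitive_indecproj _)) subr0 !addr0.
Qed.

Lemma lift1 : lift 1 = 1.
Proof.
rewrite liftE /lift_rest red1; last exact: (lift_rest_bilin lift_lin).
by rewrite h1 (lin0 lin_indecproj) subrr eps1 scale1r !addr0.
Qed.

Lemma primproj_lift_rest x : primproj (lift_rest lift x) = 0.
Proof.
rewrite (lin_of_red _ _ lin_primproj) -[RHS](red0 H x); apply: eq_red => a b ea _.
by apply: primproj_ladder; [exact: primitive_primproj|rewrite eps_lift].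
Qed.

Lemma primproj_lift x : eps x = 0 ->
  primproj (lift x) = h x - indecproj (lift_rest lift x).
Proof.
move=> ex; rewrite liftE ex scale0r add0r (linD _ _ lin_primproj).
rewrite primproj_lift_rest addr0 primproj_id //.
by apply: primitiveB; [exact: h_prim|exact: primitive_indecproj].
Qed.

Lemma lift_decomp x : eps x = 0 -> lift x = primproj (lift x) + lift_rest lift x.
Proof. by move=> ex; rewrite primproj_lift // {1}liftE ex scale0r add0r. Qed.

Lemma indecproj_lift x : indecproj (lift x) = h x.
Proof.
apply: (lin_eps_ext (f := fun y => indecproj (lift y)) (g := h)); try by linear_tac.
  move=> {}x ex; rewrite liftE ex scale0r add0r (linD _ _ lin_indecproj).
  rewrite indecproj_id ?subrK //.
  by apply: primitiveB; [exact: h_prim|exact: primitive_indecproj].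
by rewrite lift1 h1 indecproj1.
Qed.

(** The computation of [primitive_primproj] carried along [lift]: the primitive summand has no
    reduced coproduct, induction moves [lift] through the coproduct of the left leg, and after
    coassociativity [lift_decomp] reassembles the right leg. *)
Lemma lift_coalg : coalg lift.
Proof.
split; [exact: lift_lin|exact: lift1|exact: eps_lift|move=> V B x].
elim/F_ind: x V B => n x Fx IH V B bB.
have Ll := lift_lin; have [Bl Br] := bB; set p := fun b => primproj (lift b).
have Lp : lin p by rewrite /p; linear_tac.
have Pp b : primitive (p b) by exact: primitive_primproj.
rewrite liftE 2!(linD _ _ (lin_red B)) (linZ _ _ (lin_red B)) red1 // scaler0 add0r.
rewrite (red_prim bB) ?add0r; last first.
  by apply: primitiveB; [exact: h_prim|exact: primitive_indecproj].
rewrite {1}/lift_rest (lin_of_red _ _ (lin_red B)).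
pose t a b c := B (lift a) (L (p c) (lift b)).
have -> : red (fun a b => red B (L (primproj (lift b)) (lift a))) x =
    red (fun a b => B (lift a) (p b) + red (fun a1 a2 => t a1 a2 b) a) x.
  apply: (red_congr (n := n)) => // [||k l a b kn ln Fa Fb ea eb].
  - by have LB := lin_red B; linear_tac.
  - by rewrite /red /t; linear_tac.
  - rewrite -/(p b) (red_ladder _ bB (Pp b)) rho_id ?eps_lift //; congr (_ + _).
    by apply: (IH k) => //; linear_tac.
rewrite red_add red_coassoc; last by split; rewrite /t; linear_tac.
rewrite -red_add; apply: eq_red => a b _ eb.
by rewrite -(lin_of_red _ _ (Br _)) -(linD _ _ (Br _)) [in RHS](lift_decomp eb).
Qed.
End Lift.

(** Let d = f (x y) - f x f y. Two nested inductions, on the degree of x for all y and then on that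
    of y, remove every term of the coproduct of d except d (x) 1 and 1 (x) d. So d is primitive, and
    [indecproj] fixes it while killing both f (x y) and f x f y. *)
Lemma coalg_mul f : coalg f ->
  (forall x y, eps x = 0 -> eps y = 0 -> indecproj (f (x * y)) = 0) ->
  forall x y, f (x * y) = f x * f y.
Proof.
move=> cf E; have [Lf f1 ef rf] := cf.
suff H0 x y : eps x = 0 -> eps y = 0 -> f (x * y) = f x * f y.
  move=> x y; have Ly : lin (fun y => f (x * y)) by linear_tac.
  apply: (lin_eps_ext (f := fun y => f (x * y)) (g := fun y => f x * f y));
    [|by rewrite !mulr1 f1 mulr1|by linear_tac|by linear_tac].
  move=> {}y ey; apply: (lin_eps_ext (f := fun x => f (x * y)) (g := fun x => f x * f y));
    [|by rewrite !mul1r f1 mul1r|by linear_tac|by linear_tac].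
  by move=> {Ly}x ex; exact: H0.
(* The contribution of the legs a, b of x and a', b' of y; it vanishes once [f] is multiplicative on
   the two left legs and on the two right legs. *)
pose Q a b a' b' := tens (f (a * a')) (f (b * b')) - tens (f a * f a') (f b * f b').
elim/F_ind: x y => n x Fx IHx y; elim/F_ind: y => m y Fy IHy ex ey.
have D0 : Delta (f (x * y) - f x * f y) =
    bil (fun a b => bil (fun a' b' => Q a b a' b') (Delta y)) (Delta x).
  rewrite (linB _ _ Delta_lin) DeltaM !(coalg_Delta _ cf) DeltaM !bilM; try by linear_tac.
  rewrite (lin_of_bil _ _ _ (lin_mulr _)) -bil_sub; apply: eq_bil => a b.
  rewrite (lin_of_bil _ _ _ (lin_mull _)) -bil_sub; apply: eq_bil => a' b'.
  by rewrite tensM.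
have bQ a b : bilin (Q a b) by rewrite /Q; linear_tac.
have bQ' a' b' : bilin (fun a b => Q a b a' b') by rewrite /Q; linear_tac.
have Qy a b : bil (Q a b) (Delta y) = red (Q a b) y + Q a b y 1 + Q a b 1 y.
  by rewrite bil_red // ey scale0r subr0.
have f1r a : f (a * 1) = f a * f 1 by rewrite f1 !mulr1.
have f1l a : f (1 * a) = f 1 * f a by rewrite f1 !mul1r.
have Q0 a b a' b' : f (a * a') = f a * f a' -> f (b * b') = f b * f b' ->
  Q a b a' b' = 0 by move=> E1 E2; rewrite /Q E1 E2 subrr.
pose B a b := red (Q a b) y + Q a b y 1 + Q a b 1 y.
have bB : bilin B by rewrite /B /red /Q; linear_tac.
have DB : Delta (f (x * y) - f x * f y) = red B x + B x 1 + B 1 x.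
  rewrite D0; transitivity (bil B (Delta x)); first exact: eq_bil.
  by rewrite bil_red // ex scale0r subr0.
have z2 : bilin (fun _ _ : H => 0 : H2) by linear_tac.
have redB : red B x = 0.
  rewrite -[RHS](red0 H2 x); apply: (red_congr (n := n)) => // k l a b kn ln Fa Fb ea eb.
  have Ma := IHx k a kn Fa; have Mb := IHx l b ln Fb.
  have Z1 : Q a b y 1 = 0 by apply: Q0; [exact: Ma|exact: f1r].
  have Z2 : Q a b 1 y = 0 by apply: Q0; [exact: f1r|exact: Mb].
  rewrite /B Z1 Z2 !addr0 -[RHS](red0 H2 y); apply: eq_red => a' b' ea' eb'.
  by apply: Q0; [exact: Ma|exact: Mb].
(* One leg of x is now x itself, so only the inner induction on y applies; the other leg is 1, where
   multiplicativity is immediate. *)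
have redQl : red (Q x 1) y = 0.
  rewrite -[RHS](red0 H2 y); apply: (red_congr (n := m)) => // k l a b kn ln Fa Fb ea eb.
  by apply: Q0; [exact: (IHy k)|exact: f1l].
have redQr : red (Q 1 x) y = 0.
  rewrite -[RHS](red0 H2 y); apply: (red_congr (n := m)) => // k l a b kn ln Fa Fb ea eb.
  by apply: Q0; [exact: f1l|exact: (IHy l)].
have Pd : primitive (f (x * y) - f x * f y).
  rewrite /primitive DB redB add0r /B redQl redQr !add0r.
  rewrite (Q0 _ _ _ _ (f1r x) (f1l y)) (Q0 _ _ _ _ (f1l y) (f1r x)) addr0 add0r /Q !mulr1 f1 !mulr1.
  by rewrite -(linB _ _ (lin_tensl T 1)) -(linB _ _ (lin_tensr T 1)).
apply/eqP; rewrite -subr_eq0 -(indecproj_id Pd) (linB _ _ lin_indecproj) E //.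
by rewrite indecprojM ?ef // subrr.
Qed.

Lemma coalg_id : coalg (fun x => x).
Proof. by []. Qed.

Lemma coalg_comp f g : coalg f -> coalg g -> coalg (f \o g).
Proof.
move=> [Lf f1 ef rf] [Lg g1 eg rg]; split=> [|/=|x /=|V B x bB /=].
- exact: lin_comp.
- by rewrite g1.
- by rewrite ef.
- by rewrite rf // rg //; linear_tac.
Qed.

Lemma coalg_primitive f p : coalg f -> primitive p -> primitive (f p).
Proof.
move=> cf Pp; have [Lf f1 ef rf] := cf; rewrite /primitive coalg_Delta // Pp linD;
  last exact: lin_bil.
by rewrite !bil_tens ?f1 //; linear_tac.
Qed.

(** * Bialgebra automorphisms and the section *)

Definition bialg (f : H -> H) : Prop :=
  [/\ lin f, bijective f, f 1 = 1 /\ (forall x y, f (x * y) = f x * f y),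
      (forall x, Delta (f x) = bil (fun a b => tens (f a) (f b)) (Delta x)) &
      (forall x, eps (f x) = eps x)].

Definition GLprimitive (g : H -> H) : Prop :=
  [/\ (forall (a : rat) x y, primitive x -> primitive y -> g (a *: x + y) = a *: g x + g y),
      (forall x, primitive x -> primitive (g x)),
      (forall x y, primitive x -> primitive y -> g x = g y -> x = y) &
      (forall y, primitive y -> exists2 x, primitive x & g x = y)].

Lemma bialg_coalg f : bialg f -> coalg f.
Proof.
move=> [Lf _ [f1 _] Df ef]; split=> // V B x bB.
have rf a : rho (f a) = f (rho a) by rewrite /rho ef (linB _ _ Lf) (linZ _ _ Lf) f1.
rewrite /red Df (lin_of_bil _ _ _ (lin_bil _ _)); apply: eq_bil => a b.
by rewrite bil_tens ?rf //; linear_tac.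
Qed.

(** The convolution of [f] with [h] at x is f x + h x, minus the multiple eps(x) of 1, plus a
    reduced sum that sees [f] only in lower degree; so it determines [f] by induction. *)
Lemma convol_cancel (f g h : H -> H) : lin f -> lin g -> lin h -> f 1 = 1 -> g 1 = 1 -> h 1 = 1 ->
  (forall x, bil (fun a b => f a * h b) (Delta x) = bil (fun a b => g a * h b) (Delta x)) ->
  f =1 g.
Proof.
move=> Lf Lg Lh f1 g1 h1 E; elim/F_ind => n x Fx IH.
have := E x; rewrite !bil_red; try by linear_tac.
rewrite (red_congr (n := n) (C := fun a b => g a * h b) _ _ Fx); try by linear_tac.
  by rewrite f1 g1 h1 !mulr1 mul1r => /addIr/addIr/addrI.
by move=> k l a b kn ln Fa Fb ea eb; rewrite (IH k a).
Qed.

Lemma bialg_antipode f : bialg f -> forall x, S (f x) = f (S x).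
Proof.
move=> [Lf _ [f1 fM] Df ef].
apply: (@convol_cancel (fun x => S (f x)) (fun x => f (S x)) f);
  [by linear_tac|by linear_tac|exact: Lf|by rewrite f1|by rewrite S1|exact: f1|].
move=> x; transitivity (eps x *: (1 : H)).
  rewrite -ef -S_convol Df (lin_of_bil _ _ _ (lin_bil _ _)); apply: eq_bil => a b.
  by rewrite bil_tens //; linear_tac.
rewrite -f1 -(linZ _ _ Lf) -S_convol (lin_of_bil _ _ _ Lf); apply: eq_bil => a b.
by rewrite fM.
Qed.

Lemma bialg_GLprimitive f : bialg f -> GLprimitive f.
Proof.
move=> bf; have cf := bialg_coalg bf; case: bf => Lf [g fK gK] _ Df ef.
have [_ f1 _ _] := cf.
split=> [a x y _ _|x|x y _ _ /(can_inj fK)|y Py] //.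
  exact: coalg_primitive.
exists (g y); last exact: gK.
have Lg : lin g by move=> a u v; apply: (can_inj fK); rewrite Lf !gK.
have g1 : g 1 = 1 by rewrite -{1}f1 fK.
(* Applying g (x) g to the coproduct of y = f (g y) turns it into that of g y. *)
have := congr1 (bil (fun a b => tens (g a) (g b))) Py.
rewrite -{1}(gK y) Df linD; last exact: lin_bil.
rewrite !bil_tens; try by linear_tac.
rewrite g1 /primitive => <-; rewrite (lin_of_bil _ _ _ (lin_bil _ _)).
rewrite -[LHS](bil_tensE T); apply: eq_bil => a b.
by rewrite bil_tens ?fK //; linear_tac.
Qed.

(** [g] is controlled on primitive elements only; composing it with [indecproj] gives a map linear
    on all of [H]. *)
Definition primitive_section (g : H -> H) : H -> H := lift (fun x => g (indecproj x)).
Local Notation sec := primitive_section.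

Definition primitive_linear (g : H -> H) : Prop :=
  (forall (a : rat) x y, primitive x -> primitive y -> g (a *: x + y) = a *: g x + g y) /\
  (forall x, primitive x -> primitive (g x)).

Section SectionFacts.
Variable g : H -> H.
Hypothesis g_lin : primitive_linear g.

Let h_lin : lin (fun x => g (indecproj x)).
Proof.
by move=> a x y; rewrite lin_indecproj g_lin.1 //; exact: primitive_indecproj.
Qed.

Let h_prim x : primitive (g (indecproj x)).
Proof. by apply: g_lin.2; exact: primitive_indecproj. Qed.

Lemma primitive_linear0 : g 0 = 0.
Proof.
have := g_lin.1 1 0 0 primitive0 primitive0; rewrite !scale1r addr0.
by move/(congr1 (fun u => u - g 0)); rewrite addrK subrr.
Qed.

Let h1 : g (indecproj 1) = 0.
Proof. by rewrite indecproj1 primitive_linear0. Qed.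

Lemma section_coalg : coalg (sec g).
Proof. exact: lift_coalg. Qed.

Lemma indecproj_section x : indecproj (sec g x) = g (indecproj x).
Proof. exact: (indecproj_lift h_lin). Qed.

Lemma section_primitive p : primitive p -> sec g p = g p.
Proof.
move=> Pp; rewrite -(indecproj_id (coalg_primitive section_coalg Pp)).
by rewrite indecproj_section indecproj_id.
Qed.

Lemma sectionM x y : sec g (x * y) = sec g x * sec g y.
Proof.
apply: coalg_mul section_coalg _ x y => x y ex ey.
by rewrite indecproj_section indecprojM // primitive_linear0.
Qed.
End SectionFacts.

Lemma section_ext g g' : primitive_linear g -> (forall x, primitive x -> g x = g' x) ->
  sec g =1 sec g'.
Proof.
move=> lg E; have lg' : primitive_linear g'.
  split=> [a x y Px Py|x Px]; last by rewrite -E //; exact: lg.2.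
  by rewrite -!E ?lg.1 //; exact: primitive_lin.
apply: coalg_inj => [||x]; try exact: section_coalg.
by rewrite !indecproj_section // E //; exact: primitive_indecproj.
Qed.

Lemma section_comp g h : primitive_linear g -> primitive_linear h ->
  sec (g \o h) =1 sec g \o sec h.
Proof.
move=> lg lh; have lgh : primitive_linear (g \o h).
  split=> [a x y Px Py|x Px] /=; last by apply: lg.2; exact: lh.2.
  by rewrite lh.1 // lg.1 //; exact: lh.2.
apply: coalg_inj => [||x]; first exact: section_coalg.
  by apply: coalg_comp; exact: section_coalg.
by rewrite /= !indecproj_section.
Qed.

Lemma section_id g : (forall x, primitive x -> g x = x) -> sec g =1 id.
Proof.
move=> E; have lg : primitive_linear g.
  split=> [a x y Px Py|x Px]; last by rewrite E.
  by rewrite !E //; exact: primitive_lin.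
apply: coalg_inj => [||x]; [exact: section_coalg|exact: coalg_id|].
by rewrite indecproj_section // E //; exact: primitive_indecproj.
Qed.

Lemma GLprimitive_linear g : GLprimitive g -> primitive_linear g.
Proof. by case. Qed.

(** Bijectivity of the lift asks for an actual inverse function. Primitivity and [g x = y] are
    decidable equations, so [xchoose] can select preimages; the value 0 at non-primitive elements is
    arbitrary. *)
Lemma GLprimitive_inv g : GLprimitive g -> exists g', [/\ primitive_linear g',
  forall x, primitive x -> g' (g x) = x & forall x, primitive x -> g (g' x) = x].
Proof.
move=> [gl gp gi gs].
have gs' y : Delta y = tens y 1 + tens 1 y ->
    exists x, (Delta x == tens x 1 + tens 1 x) && (g x == y).
  by move=> /gs [x Px gx]; exists x; rewrite Px gx !eqxx.
pose g' y := match Delta y =P tens y 1 + tens 1 y with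
             | ReflectT Py => xchoose (gs' y Py) | ReflectF _ => 0 end.
have g'P y : primitive y -> primitive (g' y) /\ g (g' y) = y.
  rewrite /g' => Py; case: eqP => // {}Py.
  by have /andP[/eqP ? /eqP ?] := xchooseP (gs' y Py).
exists g'; split=> [|x Px|x Px]; last by case: (g'P x Px).
  split=> [a x y Px Py|x Px]; last by case: (g'P x Px).
  have [Px' gx] := g'P x Px; have [Py' gy] := g'P y Py.
  have [Pz' gz] := g'P _ (primitive_lin a Px Py).
  by apply: gi => //; [exact: primitive_lin|rewrite gl // gx gy].
by have [Pg gg] := g'P _ (gp x Px); apply: gi.
Qed.

(** The inverse is the section at the inverse of [g], by [section_comp] and [section_id]. *)
Lemma section_bialg g : GLprimitive g -> bialg (sec g).
Proof.
move=> Gg; have lg := GLprimitive_linear Gg.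
have [g' [lg' gK g'K]] := GLprimitive_inv Gg.
have cg := section_coalg lg; have [Ls s1 es rs] := cg.
split=> //.
- exists (sec g') => x.
    by rewrite -[LHS](section_comp lg' lg x) section_id.
  by rewrite -[LHS](section_comp lg lg' x) section_id.
- by split=> //; exact: sectionM.
- by move=> x; exact: coalg_Delta.
Qed.

Theorem bialg_semidirect :
  (forall f, bialg f -> forall x, S (f x) = f (S x)) /\
  (forall f, bialg f -> GLprimitive f) /\
  [/\ (forall g, GLprimitive g -> bialg (sec g)),
      (forall g, GLprimitive g -> forall x, primitive x -> sec g x = g x),
      (forall g g', GLprimitive g -> (forall x, primitive x -> g x = g' x) ->
         sec g =1 sec g') &
      (forall g h, GLprimitive g -> GLprimitive h -> sec (g \o h) =1 sec g \o sec h)].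
Proof.
split; [exact: bialg_antipode|split; [exact: bialg_GLprimitive|split]].
- exact: section_bialg.
- by move=> g /GLprimitive_linear lg x; exact: section_primitive.
- by move=> g g' /GLprimitive_linear; exact: section_ext.
- by move=> g h /GLprimitive_linear lg /GLprimitive_linear; exact: section_comp.
Qed.
End Cofree.

(** * The tensor square as polynomials in two copies of the variables *)

HB.lock Definition injl {I : choiceType} (x : Poly I) : Poly (I + I)%type :=
  subst (fun i => pvar (inl i : (I + I)%type)) x.
HB.lock Definition injr {I : choiceType} (x : Poly I) : Poly (I + I)%type :=
  subst (fun i => pvar (inr i : (I + I)%type)) x.

Section Inj.
Variable I : choiceType.
Implicit Types x y : Poly I.

Lemma lin_injl : lin (@injl I).
Proof. by rewrite injl.unlock; exact: lin_subst. Qed.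
Lemma lin_injr : lin (@injr I).
Proof. by rewrite injr.unlock; exact: lin_subst. Qed.
Lemma injl1 : injl (1 : Poly I) = 1.
Proof. by rewrite injl.unlock; exact: subst1. Qed.
Lemma injr1 : injr (1 : Poly I) = 1.
Proof. by rewrite injr.unlock; exact: subst1. Qed.
Lemma injlM x y : injl (x * y) = injl x * injl y.
Proof. by rewrite injl.unlock; exact: substM. Qed.
Lemma injrM x y : injr (x * y) = injr x * injr y.
Proof. by rewrite injr.unlock; exact: substM. Qed.
Lemma injl_var i : injl (pvar i) = pvar (inl i) :> Poly (I + I)%type.
Proof. by rewrite injl.unlock; exact: subst_var. Qed.
Lemma injr_var i : injr (pvar i) = pvar (inr i) :> Poly (I + I)%type.
Proof. by rewrite injr.unlock; exact: subst_var. Qed.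
End Inj.

HB.lock Definition ptens {I : choiceType} (x y : Poly I) : Poly (I + I)%type :=
  injl x * injr y.

Section PolyTensor.
Variable I : choiceType.
Local Notation H := (Poly I).
Local Notation H2 := (Poly (I + I)%type).
Implicit Types (x y : H) (z : H2).


Definition lvar (i : I + I) : H := if i is inl j then pvar j else 1.
Definition rvar (i : I + I) : H := if i is inr j then pvar j else 1.
Definition pleft (m : {cmonom (I + I)%type}) : H := monev lvar m.
Definition pright (m : {cmonom (I + I)%type}) : H := monev rvar m.

Lemma lin_ptensl y : lin (ptens^~ y).
Proof. rewrite ptens.unlock; exact: lin_comp (@lin_injl I) (lin_mulr (injr y)). Qed.

Lemma lin_ptensr x : lin (ptens x).
Proof. rewrite ptens.unlock; exact: lin_comp (@lin_injr I) (lin_mull (injl x)). Qed.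

Lemma ptens_bilin : bilin (@ptens I).
Proof. split; [exact: lin_ptensl|exact: lin_ptensr]. Qed.

Lemma ptensM x y x' y' : ptens x y * ptens x' y' = ptens (x * x') (y * y').
Proof. by rewrite ptens.unlock (injlM x x') (injrM y y') [RHS]mulrACA. Qed.

Lemma ptens11 : ptens (1 : H) (1 : H) = 1.
Proof. by rewrite ptens.unlock injl1 injr1 mul1r. Qed.

Lemma ptens_varl i x y : ptens (pvar i * x) y = pvar (inl i) * ptens x y.
Proof. rewrite ptens.unlock (injlM (pvar i) x) injl_var; exact: esym (mulrA _ _ _). Qed.

Lemma ptens_varr i x y : ptens x (pvar i * y) = pvar (inr i) * ptens x y.
Proof. rewrite ptens.unlock (injrM (pvar i) y) injr_var; exact: mulrCA. Qed.

Lemma pleft1 : pleft (onecm (I + I)%type) = 1 :> H. Proof. exact: monev1. Qed.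
Lemma pright1 : pright (onecm (I + I)%type) = 1 :> H. Proof. exact: monev1. Qed.
Lemma pleftM i m : pleft (mulcm (ucm i) m) = lvar i * pleft m.
Proof. by rewrite /pleft (monevM _ (ucm i) m) monevU. Qed.
Lemma prightM i m : pright (mulcm (ucm i) m) = rvar i * pright m.
Proof. by rewrite /pright (monevM _ (ucm i) m) monevU. Qed.

(** A tensor of two basis monomials is a basis monomial in the doubled variables, from which [pleft]
    and [pright] read both factors back. This is the reason why sums over monomials evaluate
    bilinear maps correctly. *)
Lemma ptens_mono m n : exists k,
  [/\ ptens << m >> << n >> = << k >>, pleft k = << m >> & pright k = << n >>].
Proof.
elim/cmonom_ind: m => [|i m [k [E1 E2 E3]]].
  elim/cmonom_ind: n => [|i n [k [E1 E2 E3]]].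
    exists (onecm (I + I)%type); split; [exact: ptens11|exact: pleft1|exact: pright1].
  exists (mulcm (ucm (inr i)) k); split.
  - apply: etrans (congr1 (ptens _) (monoM (ucm i) n)) _.
    apply: etrans (ptens_varr _ _ _) _.
    exact: etrans (congr1 ( *%R _) E1) (esym (monoM _ _)).
  - rewrite pleftM E2; exact: mul1r.
  - rewrite prightM E3; exact: esym (monoM _ _).
exists (mulcm (ucm (inl i)) k); split.
- apply: etrans (congr1 (ptens^~ _) (monoM (ucm i) m)) _.
  apply: etrans (ptens_varl _ _ _) _.
  exact: etrans (congr1 ( *%R _) E1) (esym (monoM _ _)).
- rewrite pleftM E2; exact: esym (monoM _ _).
- rewrite prightM E3; exact: mul1r.
Qed.

Lemma ptens_pleft_pright m : ptens (pleft m) (pright m) = << m >>.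
Proof.
elim/cmonom_ind: m => [|[i|i] m IH]; first by rewrite pleft1 pright1 ptens11.
- have rE := etrans (prightM (inl i) m) (mul1r _).
  rewrite (pleftM (inl i) m) rE (ptens_varl i (pleft m)).
  exact: etrans (congr1 ( *%R _) IH) (esym (monoM _ _)).
- have lE := etrans (pleftM (inr i) m) (mul1r _).
  rewrite (prightM (inr i) m) lE (ptens_varr i (pleft m)).
  exact: etrans (congr1 ( *%R _) IH) (esym (monoM _ _)).
Qed.

Lemma ptens_span z :
  \sum_(m <- msupp z) z@_m *: ptens (pleft m) (pright m) = z.
Proof.
rewrite [RHS]malg_expand; apply: eq_bigr => m _.
by rewrite ptens_pleft_pright.
Qed.

Lemma pbil_tens (V : lmodType rat) (B : H -> H -> V) x y : bilin B ->
  lext (fun m => B (pleft m) (pright m)) (ptens x y) = B x y.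
Proof.
move=> [Bl Br]; set b := lext _.
have Lb : lin b by exact: lin_lext.
rewrite (lextE x (lin_comp (lin_ptensl y) Lb)).
rewrite (lextE x (Bl y)); apply: eq_lext => m _.
rewrite (lextE y (lin_comp (lin_ptensr _) Lb)).
rewrite (lextE y (Br _)); apply: eq_lext => n _.
have [k [-> E2 E3]] := ptens_mono m n.
by rewrite /b lextU scale1r E2 E3.
Qed.

Definition poly_tensor : tensor H H2 :=
  @Tensor H H2 ptens {cmonom (I + I)%type} (fun z => msupp z)
    (fun z m => z@_m) pleft pright ptens_bilin ptensM ptens11 ptens_span
    (fun V B => lin_lext (fun m => B (pleft m) (pright m))) pbil_tens.
End PolyTensor.

(** * Trees generated by grafting *)

Section Weight.
Variables (I : choiceType) (w : I -> nat).
Implicit Types (m : {cmonom I}) (x y : Poly I).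

Definition wgt m : nat := (\sum_(i <- finsupp m) m i * w i)%N.

Lemma wgtEw (d : {fset I}) m :
  (finsupp m `<=` d)%fset -> wgt m = (\sum_(i <- d) m i * w i)%N.
Proof.
move=> le; rewrite /wgt (big_fset_incl _ le) //= => i _.
by rewrite -cmE_eq0 => /eqP ->.
Qed.

Lemma wgt1 : wgt (onecm I) = 0%N.
Proof. by rewrite /wgt mdom1 big_seq_fset0. Qed.

Lemma wgtM m1 m2 : wgt (mulcm m1 m2) = (wgt m1 + wgt m2)%N.
Proof.
rewrite {1}/wgt mdomD.
rewrite (wgtEw (fsubsetUl _ (finsupp m2))) (wgtEw (fsubsetUr (finsupp m1) _)).
by rewrite -big_split /=; apply: eq_bigr => i _; rewrite cmM mulnDl.
Qed.

Lemma wgtU i : wgt (ucm i) = w i.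
Proof. by rewrite /wgt mdomU big_seq_fset1 cmUU mul1n. Qed.

Lemma wgt_eq0 m : (forall i, (0 < w i)%N) -> wgt m = 0%N -> m = onecm I.
Proof.
move=> w_gt0; elim/cmonom_ind: m => // i m _; rewrite wgtM wgtU => /eqP.
by rewrite addn_eq0 eqn0Ngt w_gt0.
Qed.

Definition wle n x : Prop := forall m, m \in msupp x -> (wgt m <= n)%N.

Lemma wle_leq n k x : wle n x -> (n <= k)%N -> wle k x.
Proof. by move=> Fx nk m /Fx /leq_trans; exact. Qed.

Lemma wle_lin n a x y : wle n x -> wle n y -> wle n (a *: x + y).
Proof.
move=> Fx Fy m /(fsubsetP (msuppD_le _ _)); rewrite in_fsetU => /orP[|/Fy //].
by move=> /(fsubsetP (msuppZ_le _ _)) /Fx.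
Qed.

Lemma wle0 n : wle n 0.
Proof. by move=> m; rewrite msupp0 in_fset0. Qed.

Lemma wle_add n x y : wle n x -> wle n y -> wle n (x + y).
Proof. by move=> Fx Fy; rewrite -[x]scale1r; exact: wle_lin. Qed.

Lemma wle_sum (T : eqType) n (r : seq T) (c : T -> rat) (f : T -> Poly I) :
  (forall i, i \in r -> wle n (f i)) -> wle n (\sum_(i <- r) c i *: f i).
Proof.
elim: r => [|i r IH] Fr; first by rewrite big_nil; exact: wle0.
rewrite big_cons; apply: wle_lin; first by apply: Fr; rewrite mem_head.
by apply: IH => j jr; apply: Fr; rewrite inE jr orbT.
Qed.

Lemma wle_mono n m : (wgt m <= n)%N -> wle n << m >>.
Proof. by move=> le k; rewrite msuppU1 in_fset1 => /eqP ->. Qed.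

Lemma wle_M n k x y : wle n x -> wle k y -> wle (n + k) (x * y).
Proof.
move=> Fx Fy m /msuppM_le [m1 [m2 [/Fx le1 /Fy le2 ->]]].
by rewrite wgtM leq_add.
Qed.

Lemma wle_1 : wle 0 1.
Proof. by apply: wle_mono; rewrite wgt1. Qed.

Lemma wle_var i : wle (w i) (pvar i).
Proof. by apply: wle_mono; rewrite wgtU. Qed.
End Weight.
Arguments wle_var {I} w i.
Arguments wle_1 {I} w.
Arguments wle0 {I} w n.

(** The condition bears only on variables of weight at most that of [m], so that in [wle_delta] the
    induction hypothesis for trees smaller than [node m] supplies it. *)
Lemma wle_monev (I J : choiceType) (wI : I -> nat) (wJ : J -> nat)
    (v : I -> Poly J) (m : {cmonom I}) :
  (forall i, (wI i <= wgt wI m)%N -> wle wJ (wI i) (v i)) ->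
  wle wJ (wgt wI m) (monev v m).
Proof.
elim/cmonom_ind: m => [|i m IH] Fv.
  by rewrite wgt1 monev1; exact: wle_1.
rewrite wgtM wgtU monevM monevU in Fv *; apply: wle_M.
  by apply: Fv; exact: leq_addr.
by apply: IH => j le; apply: Fv; exact: leq_trans le (leq_addl _ _).
Qed.

Lemma wle_subst (I J : choiceType) (wI : I -> nat) (wJ : J -> nat)
    (v : I -> Poly J) n x :
  (forall i, wle wJ (wI i) (v i)) ->
  wle wI n x -> wle wJ n (subst v x).
Proof.
move=> Fv Fx; rewrite (lextE x (lin_subst v)); apply: wle_sum => m /Fx le.
by rewrite subst_mono; apply: wle_leq le; apply: wle_monev.
Qed.

(** * Coproduct, grafting derivation and degree on polynomials in trees *)

Section FreeTrees.
Variable I : choiceType.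
Local Notation H := (Poly I).
Local Notation H2 := (Poly (I + I)%type).
Local Notation T := (poly_tensor I).
(* [node] makes a tree out of a forest (seen as a monomial) and [w] counts vertices. *)
Variables (node : {cmonom I} -> I) (w : I -> nat).
Hypothesis node_surj : forall i, exists m, i = node m.
Hypothesis w_node : forall m, w (node m) = (wgt w m).+1.

Definition grafting : H -> H := lext (fun m => pvar (node m)).
Local Notation Bp := grafting.

Definition counit (x : H) : rat := x@_(onecm I).

Lemma w_gt0 i : (0 < w i)%N.
Proof. by have [m ->] := node_surj i; rewrite w_node. Qed.

Lemma lin_grafting : lin Bp.
Proof. exact: lin_lext. Qed.

Lemma grafting_mono m : Bp << m >> = pvar (node m).
Proof. by rewrite /grafting lextU scale1r. Qed.

Lemma weight_ind (P : I -> Prop) :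
  (forall m, (forall i, (w i < w (node m))%N -> P i) -> P (node m)) -> forall i, P i.
Proof.
move=> HP i; move: {2}(w i) (leqnn (w i)) => n.
elim: n i => [|n IH] i; first by rewrite leqNgt w_gt0.
have [m ->] := node_surj i => le; apply: HP => j lt; apply: IH.
by rewrite -ltnS (leq_trans lt).
Qed.

Lemma mono_ind (P : H -> Prop) m : P 1 -> (forall x y, P x -> P y -> P (x * y)) ->
  (forall i, (w i < w (node m))%N -> P (pvar i)) -> P << m >>.
Proof.
move=> P1 PM; rewrite w_node; elim/cmonom_ind: m => [|i m IH] HP; first exact: P1.
rewrite monoM; apply: PM.
  by apply: HP; rewrite wgtM wgtU ltnS leq_addr.
apply: IH => j lt; apply: HP; apply: leq_trans lt _.
by rewrite wgtM wgtU ltnS leq_addl.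
Qed.

Lemma tree_ind (P : H -> Prop) :
  (forall a x y, P x -> P y -> P (a *: x + y)) -> P 1 ->
  (forall x y, P x -> P y -> P (x * y)) -> (forall x, P x -> P (Bp x)) ->
  forall x, P x.
Proof.
move=> PL P1 PM PB; have Pv i : P (pvar i).
  elim/weight_ind: i => m IH; rewrite -grafting_mono; apply: PB.
  exact: mono_ind.
by apply: (Poly_ind P1 PL) => i x; exact: PM (Pv i).
Qed.

Lemma counit1 : counit 1 = 1.
Proof. exact: mcoeffUU. Qed.

Lemma counitM x y : counit (x * y) = counit x * counit y.
Proof. exact: (mcoeff1g_is_multiplicative _ _).1. Qed.

Lemma lin_counit (V : lmodType rat) (v : V) : lin (fun x => counit x *: v).
Proof.
by move=> a x y; rewrite /counit mcoeffD mcoeffZ scalerDl scalerA.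
Qed.

Lemma counit_var i : counit (pvar i) = 0.
Proof.
rewrite /counit mcoeffU; case: eqP => // E.
by have := cm1_eq1 i; rewrite E eqxx.
Qed.

Lemma counit_grafting x : counit (Bp x) = 0.
Proof.
have L : lin (fun x => counit (Bp x) *: (1 : rat^o)).
  exact: lin_comp lin_grafting (lin_counit _).
have := lextE x L; rewrite /lext big1 => [|m _].
  by rewrite /GRing.scale /= mulr1.
by rewrite grafting_mono counit_var scale0r scaler0.
Qed.

Variable delta : I -> H2.
Hypothesis delta_node : forall m, delta (node m) =
  tens T (pvar (node m)) 1 + bil T (fun a b => tens T a (Bp b)) (monev delta m).
Local Notation Delta := (subst delta).

Lemma Delta_grafting x :
  Delta (Bp x) = tens T (Bp x) 1 + bil T (fun a b => tens T a (Bp b)) (Delta x).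
Proof.
rewrite (lextE x (lin_comp lin_grafting (lin_subst delta))).
have L2 : lin (fun x => tens T (Bp x) 1 +
    bil T (fun a b => tens T a (Bp b)) (Delta x)).
  apply: lin_add; first exact: (lin_comp lin_grafting (lin_tensl T 1)).
  exact: (lin_comp (lin_subst delta) (lin_bil T _)).
rewrite [RHS](lextE x L2); apply: eq_lext => m _.
rewrite (grafting_mono m).
apply: etrans (subst_var delta (node m)) _; apply: etrans (delta_node m) _.
by rewrite (subst_mono delta m).
Qed.

Variable antip : I -> H.
Hypothesis antip_eq : forall i, antip i =
  - bil T (fun a b => subst antip a * b) (delta i - tens T (pvar i) 1).
Local Notation S := (subst antip).

Lemma antip_bilin : bilin (fun a b : H => S a * b).
Proof.
split=> [b|a]; last exact: lin_mull.
exact: lin_comp (lin_subst antip) (lin_mulr b).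
Qed.

(** By [convol_mul] the identity passes to products, so only single trees matter; there [antip_eq]
    is this identity solved for the contribution of t (x) 1. *)
Lemma antip_convol x : bil T (fun a b => S a * b) (Delta x) = counit x *: 1.
Proof.
elim/Poly_ind: x => [|a x y Hx Hy|i x Hx].
- rewrite (subst1 delta) (bil_one T antip_bilin) (subst1 antip) counit1 scale1r.
  exact: mulr1.
- have L1 := lin_comp (lin_subst delta) (lin_bil T (fun a b : H => S a * b)).
  apply: etrans (L1 a x y) _; apply: etrans (congr2 (fun u v => a *: u + v) Hx Hy) _.
  exact: esym (lin_counit (1 : H) a x y).
- rewrite (substM delta) counitM counit_var.
  apply: convol_mul (lin_subst antip) (substM antip) _ Hx.
  rewrite scale0r subst_var -[delta i](subrK (tens T (pvar i) 1)).
  rewrite (linD _ _ (lin_bil T _)).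
  rewrite (bil_tens T _ _ antip_bilin) (subst_var antip i) antip_eq mulr1.
  exact: subrr.
Qed.

(** Universal property of trees: [rec L] gives the values on trees of the ring morphism turning
    grafting onto a root into the operator [L]. *)
Variable rec : forall S : comNzRingType, (S -> S) -> I -> S.
Hypothesis recE : forall (S : comNzRingType) (L : S -> S) m,
  rec L (node m) = L (monev (rec L) m).

(** An operator on dual numbers over [H], modelled by polynomials read up to degree 1. Its constant
    coefficient copies [Bp], its coefficient of degree 1 the recursive equation of the
    derivation. *)
Definition graft_step (x : H) (p : {poly H}) : {poly H} :=
  (Bp p`_0)%:P + (Bp (x * p`_0) + Bp p`_1)%:P * 'X.

Definition graft_poly (x y : H) : {poly H} :=
  mmap (polyC \o in_alg H) (monev (rec (graft_step x))) y.

(* [graft x] is the derivation with [graft x (B+ y) = B+ (x y) + B+ (graft x y)]: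
   it is read off an algebra morphism into polynomials, as the coefficient
   of degree 1. *)
Definition graft (x y : H) : H := (graft_poly x y)`_1.

Lemma graft_polyM x y z : graft_poly x (y * z) = graft_poly x y * graft_poly x z.
Proof. exact: (mmap_is_multiplicative (f := polyC \o in_alg H)
  (h := monev (rec (graft_step x)))).1. Qed.

Lemma graft_poly1 x : graft_poly x 1 = 1.
Proof. exact: (mmap1 (f := polyC \o in_alg H) (h := monev (rec (graft_step x)))). Qed.

Lemma lin_graft_poly x k : lin (fun y => (graft_poly x y)`_k).
Proof.
move=> a y z; rewrite /graft_poly mmapD mmapZ coefD; congr (_ + _).
apply: etrans (coefCM _ _ _) _; exact: mulr_algl.
Qed.

Lemma graft_poly_mono x m : graft_poly x << m >> = monev (rec (graft_step x)) m.
Proof. by rewrite /graft_poly mmapU /= scale1r polyC1 mul1r. Qed.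

Lemma graft_poly_node x m :
  graft_poly x (pvar (node m)) = graft_step x (graft_poly x << m >>).
Proof.
apply: etrans (graft_poly_mono x (ucm (node m))) _.
apply: etrans (monevU _ (node m)) _; apply: etrans (recE _ m) _.
by rewrite (graft_poly_mono x m).
Qed.

Lemma graft_step0 x p : (graft_step x p)`_0 = Bp p`_0.
Proof. by rewrite /graft_step coefD coefMX /= coefC addr0. Qed.

Lemma graft_step1 x p : (graft_step x p)`_1 = Bp (x * p`_0) + Bp p`_1.
Proof. rewrite /graft_step coefD coefMX [X in X + _]coefC [X in _ + X]coefC; exact: add0r. Qed.

Lemma graft_poly_grafting0 x y :
  (graft_poly x (Bp y))`_0 = Bp (graft_poly x y)`_0.
Proof.
have L1 := lin_comp lin_grafting (lin_graft_poly x 0).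
have L2 := lin_comp (lin_graft_poly x 0) lin_grafting.
apply: (malg_ext L1 L2) => m; rewrite (grafting_mono m).
apply: etrans (congr1 (fun p : {poly H} => p`_0) (graft_poly_node x m)) _.
exact: graft_step0.
Qed.

(** The constant coefficient is an algebra morphism commuting with [Bp], hence the identity. The
    coefficient of degree 1 is then a derivation over the identity, which is the Leibniz rule
    [graftM]. *)
Lemma graft_poly0 x y : (graft_poly x y)`_0 = y.
Proof.
elim/tree_ind: y => [a y z Hy Hz||y z Hy Hz|y Hy].
- apply: etrans (lin_graft_poly x 0 a y z) _.
  exact (congr2 (fun u v : H => a *: u + v) Hy Hz).
- by rewrite graft_poly1 coef1.
- rewrite graft_polyM coef0M; exact (congr2 (fun u v : H => u * v) Hy Hz).
- rewrite graft_poly_grafting0; exact (congr1 Bp Hy).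
Qed.

Lemma lin_graft x : lin (graft x).
Proof. exact: lin_graft_poly. Qed.

Lemma graftM x y z : graft x (y * z) = graft x y * z + y * graft x z.
Proof.
apply: etrans (congr1 (fun p : {poly H} => p`_1) (graft_polyM x y z)) _.
apply: etrans (coef1M _ _) _.
exact (congr2 (fun u v : H => graft x y * v + u * graft x z)
  (graft_poly0 x y) (graft_poly0 x z)).
Qed.

Lemma graft_grafting x y : graft x (Bp y) = Bp (x * y) + Bp (graft x y).
Proof.
have L1 : lin (fun y => graft x (Bp y)).
  exact: lin_comp lin_grafting (lin_graft x).
have L2 : lin (fun y => Bp (x * y) + Bp (graft x y)).
  apply: lin_add; first exact: lin_comp (lin_mull x) lin_grafting.
  exact: lin_comp (lin_graft x) lin_grafting.
apply: (malg_ext L1 L2) => m; rewrite (grafting_mono m).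
apply: etrans (congr1 (fun p : {poly H} => p`_1) (graft_poly_node x m)) _.
apply: etrans (graft_step1 _ _) _.
by rewrite (graft_poly0 x << m >>).
Qed.

Lemma graftx1 x : graft x 1 = 0.
Proof.
have := graftM x 1 1; rewrite mul1r (mul1r (graft x 1)) (mulr1 (graft x 1)).
by move/(congr1 (fun u => u - graft x 1)); rewrite addrK subrr.
Qed.

Lemma graft1_monev (J : choiceType) (wJ : J -> nat) (v : J -> H) m :
  (forall j, (wJ j <= wgt wJ m)%N -> graft 1 (v j) = (wJ j)%:R *: v j) ->
  graft 1 (monev v m) = (wgt wJ m)%:R *: monev v m.
Proof.
elim/cmonom_ind: m => [|j m IH] Ev.
  by rewrite wgt1 monev1 scale0r; exact: graftx1.
rewrite wgtM wgtU monevM monevU in Ev *.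
apply: derivation_eigen (graftM _ _ _) _ _.
  by apply: Ev; exact: leq_addr.
by apply: IH => i le; apply: Ev; exact: leq_trans le (leq_addl _ _).
Qed.

(** D_1 (B+ y) = B+ y + B+ (D_1 y): the first summand counts the root, the second the vertices of
    the forest. *)
Lemma graft1_var i : graft 1 (pvar i) = (w i)%:R *: pvar i.
Proof.
elim/weight_ind: i => m IH; rewrite -grafting_mono; apply: etrans (graft_grafting _ _) _.
have -> : graft 1 << m >> = (wgt w m)%:R *: << m >>.
  rewrite (mono_monev m); apply: graft1_monev => j le.
  by apply: IH; rewrite w_node ltnS.
rewrite (linZ _ _ lin_grafting) mul1r -{1}[Bp << m >>]scale1r w_node.
exact: (eigen_sum 1).
Qed.

Lemma graft1_mono m : graft 1 << m >> = (wgt w m)%:R *: << m >>.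
Proof. by rewrite (mono_monev m); apply: graft1_monev => j _; exact: graft1_var. Qed.

(** For the empty forest the weight is 0 and its inverse is 0 by convention, so constants are
    killed: [graft 1] is inverted on the augmentation ideal only. *)
Definition degree_inv : H -> H := lext (fun m => (wgt w m)%:R^-1 *: << m >>).

Lemma lin_degree_inv : lin degree_inv.
Proof. exact: lin_lext. Qed.

Lemma degree_inv_mono m : degree_inv << m >> = (wgt w m)%:R^-1 *: << m >>.
Proof. by rewrite /degree_inv lextU scale1r. Qed.

Lemma mono_sub_counit m :
  (wgt w m)%:R^-1 * (wgt w m)%:R *: << m >> = << m >> - counit << m >> *: 1 :> H.
Proof.
have [w0|w0] := eqVneq (wgt w m) 0%N.
  rewrite (wgt_eq0 w_gt0 w0) counit1 scale1r wgt1 mulr0 scale0r; exact: esym (subrr _).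
rewrite mulVf ?Num.Theory.pnatr_eq0 // scale1r.
have -> : counit << m >> = 0.
  rewrite /counit mcoeffU; case: eqP => // E.
  by move: w0; rewrite E wgt1.
by rewrite scale0r subr0.
Qed.

Lemma lin_sub_counit : lin (fun x : H => x - counit x *: 1).
Proof. by apply: lin_sub; [exact: lin_id|exact: lin_counit]. Qed.

Lemma graft1_degree_inv x : graft 1 (degree_inv x) = x - counit x *: 1.
Proof.
have L1 := lin_comp lin_degree_inv (lin_graft 1).
apply: (malg_ext L1 lin_sub_counit) => m.
rewrite degree_inv_mono (linZ _ _ (lin_graft 1)) (graft1_mono m) scalerA.
exact: mono_sub_counit.
Qed.

Lemma degree_inv_graft1 x : degree_inv (graft 1 x) = x - counit x *: 1.
Proof.
have L1 := lin_comp (lin_graft 1) lin_degree_inv.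
apply: (malg_ext L1 lin_sub_counit) => m.
rewrite (graft1_mono m) (linZ _ _ lin_degree_inv) degree_inv_mono scalerA mulrC.
exact: mono_sub_counit.
Qed.

Definition wsum (s : I + I) : nat := match s with inl j | inr j => w j end.
Definition wleft (s : I + I) : nat := if s is inl j then w j else 0%N.
Definition wright (s : I + I) : nat := if s is inr j then w j else 0%N.

Lemma wsum_gt0 s : (0 < wsum s)%N.
Proof. by case: s => j; exact: w_gt0. Qed.

Lemma wgt_wsum m : wgt wsum m = (wgt wleft m + wgt wright m)%N.
Proof.
elim/cmonom_ind: m => [|s m IH]; first by rewrite !wgt1.
by rewrite !wgtM !wgtU IH addnACA; congr (_ + _)%N; case: s => j; rewrite ?addn0.
Qed.

Lemma graft1_pleft m : graft 1 (pleft m) = (wgt wleft m)%:R *: pleft m.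
Proof.
apply: graft1_monev => -[j|j] _; first exact: graft1_var.
by rewrite scale0r; exact: graftx1.
Qed.

Lemma graft1_pright m : graft 1 (pright m) = (wgt wright m)%:R *: pright m.
Proof.
apply: graft1_monev => -[j|j] _; last exact: graft1_var.
by rewrite scale0r; exact: graftx1.
Qed.

Lemma mcoeff_lext_diag (c : {cmonom (I + I)%type} -> rat) (z : H2) m :
  (lext (fun m => c m *: (<< m >> : H2)) z)@_m = z@_m * c m.
Proof.
rewrite /lext raddf_sum /=; have [mz|mz] := boolP (m \in msupp z).
  rewrite (big_fsetD1 m) //= big_seq big1 ?addr0 => [|k].
    by rewrite !mcoeffZ mcoeffUU mulr1.
  by rewrite in_fsetD1 !mcoeffZ mcoeffU => /andP[/negbTE -> _]; rewrite !mulr0.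
rewrite mcoeff_outdom // mul0r big_seq big1 // => k kz.
rewrite !mcoeffZ mcoeffU; case: eqP => [E|_]; last by rewrite !mulr0.
by rewrite -E kz in mz.
Qed.

(** The operator is diagonal on monomials, with eigenvalue the total number of vertices of both
    legs; this is zero only for a pair of empty forests. *)
Lemma graft1_tens_inj z :
  bil T (fun a b => tens T (graft 1 a) b + tens T a (graft 1 b)) z = 0 ->
  exists c : rat, z = c *: 1.
Proof.
have -> : bil T (fun a b => tens T (graft 1 a) b + tens T a (graft 1 b)) z =
    lext (fun m => (wgt wsum m)%:R *: (<< m >> : H2)) z.
  apply: eq_bigr => m _; congr (_ *: _).
  transitivity ((wgt wleft m)%:R *: ptens (pleft m) (pright m) +
                (wgt wright m)%:R *: ptens (pleft m) (pright m)).
    congr (_ + _).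
      apply: etrans (congr1 (fun u => ptens u _) (graft1_pleft m)) _.
      exact: (linZ _ _ (lin_ptensl _)).
    apply: etrans (congr1 (ptens _) (graft1_pright m)) _.
    exact: (linZ _ _ (lin_ptensr _)).
  by rewrite eigen_sum wgt_wsum (ptens_pleft_pright m).
move=> E; exists z@_(onecm _); apply/malgP => m.
rewrite mcoeffZ mcoeff1; have := congr1 (fun u : H2 => u@_m) E.
rewrite mcoeff_lext_diag mcoeff0 => /eqP; rewrite mulf_eq0 Num.Theory.pnatr_eq0.
case/orP => [/eqP zm|/eqP /(wgt_eq0 wsum_gt0) ->]; last by rewrite eqxx mulr1.
case: eqP => [E1|_]; last by rewrite zm mulr0.
by rewrite mulr1 E1.
Qed.

Lemma wle_ptens n k x y : wle w n x -> wle w k y -> wle wsum (n + k) (ptens x y).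
Proof.
move=> Fx Fy; rewrite ptens.unlock; apply: wle_M.
  by rewrite injl.unlock; apply: wle_subst Fx => i; exact: (wle_var wsum (inl i)).
by rewrite injr.unlock; apply: wle_subst Fy => i; exact: (wle_var wsum (inr i)).
Qed.

Lemma wle_pleft m : wle w (wgt wleft m) (pleft m).
Proof.
apply: wle_monev => -[j|j] _; first exact: wle_var.
exact: wle_1.
Qed.

Lemma wle_pright m : wle w (wgt wright m) (pright m).
Proof.
apply: wle_monev => -[j|j] _; last exact: wle_var.
exact: wle_1.
Qed.

Lemma wle_grafting n x : wle w n x -> wle w n.+1 (Bp x).
Proof.
move=> Fx; apply: wle_sum => m /Fx le; apply: wle_leq (wle_var w _) _.
by rewrite w_node ltnS.
Qed.

Lemma wle_delta i : wle wsum (w i) (delta i).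
Proof.
elim/weight_ind: i => m IH; rewrite delta_node {1}w_node; apply: wle_add.
  rewrite -[_.+1]addn0; apply: wle_ptens; last exact: wle_1.
  by rewrite -w_node; exact: wle_var.
apply: wle_sum => k kz.
have le : (wgt wsum k <= wgt w m)%N.
  have Fm : wle wsum (wgt w m) (monev delta m).
    by apply: wle_monev => j le; apply: IH; rewrite w_node ltnS.
  exact: Fm kz.
(* Grafting the right leg onto a root adds one vertex, the one by which [node m] exceeds [m]. *)
have le1 : (wgt wleft k + (wgt wright k).+1 <= (wgt w m).+1)%N.
  by rewrite addnS ltnS -wgt_wsum.
exact (wle_leq (wle_ptens (@wle_pleft k) (wle_grafting (@wle_pright k))) le1).
Qed.

Lemma lvar1 s : wleft s = 0%N -> lvar s = 1.
Proof.
case: s => j /= E; last exact: erefl.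
by exfalso; have := w_gt0 j; rewrite E.
Qed.

Lemma rvar1 s : wright s = 0%N -> rvar s = 1.
Proof.
case: s => j /= E; first exact: erefl.
by exfalso; have := w_gt0 j; rewrite E.
Qed.

(** The weights of the two legs of a term of the coproduct add up to at most n. A leg of weight 0 is
    1 and is killed by [rho]; otherwise both weights are positive, so each is below n. *)
Lemma poly_red_congr (V : lmodType rat) (B C : H -> H -> V) n x :
  bilin B -> bilin C -> wle w n x ->
  (forall k l a b, (k < n)%N -> (l < n)%N -> wle w k a -> wle w l b ->
     counit a = 0 -> counit b = 0 -> B a b = C a b) ->
  red T Delta counit B x = red T Delta counit C x.
Proof.
move=> [Bl Br] [Cl Cr] Fx E; rewrite /red /bil.
have FD : wle wsum n (Delta x) by apply: wle_subst Fx => i; exact: wle_delta.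
apply: eq_big_seq => m mz; congr (_ *: _).
have := FD m mz; rewrite wgt_wsum => le.
have rho0 : rho counit 1 = 0 :> H by rewrite /rho counit1 scale1r; exact: subrr.
have cr (y : H) : counit (rho counit y) = 0.
  rewrite /rho /counit mcoeffB mcoeffZ -/(counit _) -/(counit 1) counit1 mulr1.
  exact: subrr.
have wr k (y : H) : wle w k y -> wle w k (rho counit y).
  move=> Fy; rewrite /rho addrC -scaleNr; apply: wle_lin Fy.
  by apply: wle_leq (wle_1 w) _.
have sum0 (y y' : H) (G : H -> H -> V) : (forall v, lin (G^~ v)) ->
    (forall u, lin (G u)) -> y = 1 \/ y' = 1 -> G (rho counit y) (rho counit y') = 0.
  move=> Gl Gr [-> | ->]; rewrite rho0; first exact: lin0 (Gl _).
  exact: lin0 (Gr _).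
have one0 (v : I + I -> H) (wv : I + I -> nat) :
    (forall s, wv s = 0%N -> v s = 1) -> wgt wv m = 0%N -> monev v m = 1.
  move=> v1; elim/cmonom_ind: (m) => [|s k IH]; first by rewrite monev1.
  rewrite wgtM wgtU monevM monevU => /eqP; rewrite addn_eq0 => /andP[/eqP w0 /eqP k0].
  by rewrite (v1 s w0) (IH k0) mulr1.
have [l0|l_gt0] := posnP (wgt wleft m).
  have El : pleft m = 1.
    exact: (one0 (@lvar I) wleft lvar1 l0).
  exact (etrans (sum0 _ _ B Bl Br (or_introl El)) (esym (sum0 _ _ C Cl Cr (or_introl El)))).
have [r0|r_gt0] := posnP (wgt wright m).
  have Er : pright m = 1.
    exact: (one0 (@rvar I) wright rvar1 r0).
  exact (etrans (sum0 _ _ B Bl Br (or_intror Er)) (esym (sum0 _ _ C Cl Cr (or_intror Er)))).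
apply: (E (wgt wleft m) (wgt wright m)); [| |exact: wr _ _ (@wle_pleft m)
  |exact: wr _ _ (@wle_pright m)|exact: cr|exact: cr].
  by apply: leq_trans le; rewrite -[X in (X < _)%N]addn0 ltn_add2l.
by apply: leq_trans le; rewrite -[X in (X < _)%N]add0n ltn_add2r.
Qed.

Definition poly_deg (x : H) : nat := (\max_(m <- msupp x) wgt w m)%N.

Lemma wle_deg x : wle w (poly_deg x) x.
Proof.
move=> m mx; rewrite /poly_deg.
exact: (leq_bigmax_seq _ mx).
Qed.

Definition tree_bialg := bialg T Delta counit.
Definition tree_GL := GLprimitive T Delta.

Definition tree_section : (H -> H) -> H -> H :=
  primitive_section T Delta counit graft degree_inv poly_deg S.

Theorem tree_semidirect :
  (forall f, tree_bialg f -> forall x, S (f x) = f (S x)) /\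
  (forall f, tree_bialg f -> tree_GL f) /\
  [/\ (forall g, tree_GL g -> tree_bialg (tree_section g)),
      (forall g, tree_GL g -> forall x, primitive T Delta x -> tree_section g x = g x),
      (forall g g', tree_GL g -> (forall x, primitive T Delta x -> g x = g' x) ->
         tree_section g =1 tree_section g') &
      (forall g h, tree_GL g -> tree_GL h ->
         tree_section (g \o h) =1 tree_section g \o tree_section h)].
Proof.
exact: (bialg_semidirect (lin_subst delta) (subst1 delta) (substM delta) lin_counit
  counit1 counitM lin_grafting counit_grafting Delta_grafting tree_ind lin_graft
  graftM graft_grafting lin_degree_inv graft1_degree_inv degree_inv_graft1
  graft1_tens_inj (@wle_deg) (@poly_red_congr) (lin_subst antip) (subst1 antip)
  (substM antip) antip_convol).
Qed.
End FreeTrees.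

(** * Admissible cuts *)

Lemma tle_perm_sort (s s' : seq rtree) : perm_eq s s' -> sort tle s = sort tle s'.
Proof.
move/perm_sortP; apply.
- by move=> a b; exact: leq_total.
- by move=> a b c; exact: leq_trans.
- move=> a b; rewrite /tle -eqn_leq => /eqP.
  exact: (pcan_inj (@choice.pickleK _)).
Qed.

Lemma canon_perm (ts us : seq rtree) :
  perm_eq (map canon ts) (map canon us) -> canon (RNode ts) = canon (RNode us).
Proof. by move=> /= /tle_perm_sort ->. Qed.

Lemma tsize_canon t : tsize (canon t) = tsize t.
Proof.
elim/rtree_ind': t => ts IH /=; congr _.+1.
rewrite !sumnE !big_map (perm_big _ (permEl (perm_sort tle _))) big_map.
by rewrite !big_seq; apply: eq_bigr => u /IH.
Qed.

Lemma val_cls t : val (cls t) = canon t. Proof. by []. Qed.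

Lemma cls_canon t : cls (canon t) = cls t.
Proof. by apply: val_inj; rewrite !val_cls canon_idem. Qed.

Lemma cls_val (i : ctree) : cls (val i) = i.
Proof. by apply: val_inj; rewrite val_cls; exact: eqP (valP i). Qed.

Lemma prodseq_cons (A : Type) (s : seq A) (ss : seq (seq A)) :
  prodseq (s :: ss) = [seq x :: y | x <- s, y <- prodseq ss].
Proof. by []. Qed.

Definition child_cuts (c : rtree) : seq (seq rtree * option rtree) :=
  ([:: c], None) :: [seq (p.1, Some p.2) | p <- cuts c].

Lemma cuts_node ts : cuts (RNode ts) =
  [seq (flatten (map fst ch), RNode (pmap snd ch)) | ch <- prodseq (map child_cuts ts)].
Proof. by []. Qed.

Lemma cuts_size t pr : pr \in cuts t -> (sumn (map tsize pr.1) + tsize pr.2 = tsize t)%N.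
Proof.
elim/rtree_ind': t pr => ts IH pr; rewrite cuts_node => /mapP[ch chP ->] /=.
rewrite addnS; congr _.+1.
elim: ts IH ch chP => [|t ts IHts] IH ch; first by rewrite inE => /eqP ->.
rewrite map_cons prodseq_cons => /allpairsP[[a r] /= [aP rP ->]] /=; rewrite map_cat sumn_cat.
have Er := IHts (fun u ut => IH u (mem_behead (s := t :: ts) ut)) r rP.
have Ea : (sumn (map tsize a.1) + oapp tsize 0 a.2 = tsize t)%N.
  move: aP; rewrite inE => /orP[/eqP -> /=|/mapP[p pP ->] /=]; first by rewrite !addn0.
  by apply: IH pP; rewrite mem_head.
by rewrite -{1}Ea -Er; case: (a.2) => [u|] /=; [rewrite addnACA|rewrite addn0 addnA].
Qed.

(** The trunk keeps the root, which makes the inequality strict and the size of a tree enough fuel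
    for the antipode. *)
Lemma cuts_size_lt t pr u : pr \in cuts t -> u \in pr.1 -> (tsize u < tsize t)%N.
Proof.
move=> /cuts_size <- /(map_f tsize) ut.
have : (tsize u <= sumn (map tsize pr.1))%N.
  elim: (map tsize pr.1) ut => //= a s IH; rewrite inE => /orP[/eqP ->|/IH le].
    exact: leq_addr.
  exact: leq_trans le (leq_addl _ _).
by move=> le; rewrite -addn1 leq_add //; case: (pr.2).
Qed.

Lemma filter_prodseq (A : Type) (p : pred A) (ss : seq (seq A)) :
  filter (all p) (prodseq ss) = prodseq (map (filter p) ss).
Proof.
elim: ss => //= s ss IH; rewrite -IH; elim: s => //= a s IHs.
rewrite filter_cat IHs filter_map; case pa: (p a) => /=.
  by congr (_ ++ _); congr map; apply: eq_filter => r /=; rewrite pa.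
rewrite (eq_filter (a2 := pred0)) ?filter_pred0 // => r /=.
by rewrite pa.
Qed.

Lemma prodseq_map1 (A B : Type) (f : A -> B) (s : seq A) :
  prodseq [seq [:: f x] | x <- s] = [:: map f s].
Proof. by elim: s => //= x s ->. Qed.

Lemma flatten_nil (A : eqType) (ss : seq (seq A)) :
  (flatten ss == [::]) = all (fun s => s == [::]) ss.
Proof. by elim: ss => //= s ss <-; case: s. Qed.

(** If nothing is pruned, nothing is pruned at any child, and induction leaves one choice there.
    This single cut gives the term 1 (x) t, which [antipode_sum] separates from the others. *)
Lemma cuts_nil t : [seq pr <- cuts t | pr.1 == [::]] = [:: ([::], t)].
Proof.
elim/rtree_ind': t => ts IH; rewrite cuts_node filter_map.
have -> : filter (preim (fun ch => (flatten (map fst ch), RNode (pmap snd ch)))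
      (fun pr => pr.1 == [::])) (prodseq (map child_cuts ts)) =
    filter (all (fun c => c.1 == [::])) (prodseq (map child_cuts ts)).
  by apply: eq_filter => ch /=; rewrite flatten_nil all_map.
rewrite filter_prodseq -map_comp.
have -> : [seq (filter (fun c => c.1 == [::]) \o child_cuts) i | i <- ts] =
    [seq [:: ([::] : seq rtree, Some c)] | c <- ts].
  by apply/eq_in_map => c /IH E; rewrite /child_cuts /= filter_map E.
rewrite (prodseq_map1 (fun c => ([::] : seq rtree, Some c))) /=.
congr [:: (_, RNode _)].
  by elim: ts {IH} => //=.
by elim: ts {IH} => //= c ts ->.
Qed.

Lemma sum_prodseq (R : comNzRingType) (A : Type) (f : A -> R) (ss : seq (seq A)) :
  \sum_(ch <- prodseq ss) \prod_(c <- ch) f c = \prod_(s <- ss) \sum_(c <- s) f c.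
Proof.
elim: ss => [|s ss IH]; first by rewrite big_seq1 !big_nil.
rewrite prodseq_cons big_allpairs_dep big_cons -IH mulr_suml; apply: eq_bigr => c _.
by rewrite mulr_sumr; apply: eq_bigr => r _; rewrite big_cons.
Qed.

(** * From admissible cuts to the cocycle equation *)

Section TreeCoproduct.
Variables (A A2 : comAlgType rat) (T : tensor A A2).
Variables (tvar : rtree -> A) (B : A -> A).
Hypothesis B_lin : lin B.
Hypothesis B_prod : forall ts, B (\prod_(t <- ts) tvar t) = tvar (RNode ts).
Hypothesis tvar_canon : forall t, tvar (canon t) = tvar t.

Definition tree_coprod (t : rtree) : A2 :=
  tens T (tvar t) 1 + \sum_(pr <- cuts t) tens T (\prod_(u <- pr.1) tvar u) (tvar pr.2).

Lemma tens_prod (J : Type) (r : seq J) (f g : J -> A) :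
  \prod_(j <- r) tens T (f j) (g j) = tens T (\prod_(j <- r) f j) (\prod_(j <- r) g j).
Proof.
elim: r => [|j r IH]; first by rewrite !big_nil tens11.
by rewrite !big_cons IH tensM.
Qed.

(** A cut is an independent choice for each child t of the root: the edge above t, giving t (x) 1,
    or a possibly empty cut inside t. So the sum over cuts is the product of the coproducts of the
    children, and [B] puts the root back on the trunk. *)
Lemma tree_coprod_node ts : tree_coprod (RNode ts) = tens T (tvar (RNode ts)) 1 +
  bil T (fun a b => tens T a (B b)) (\prod_(t <- ts) tree_coprod t).
Proof.
have bB : bilin (fun a b => tens T a (B b)).
  by split=> [b|a]; [exact: lin_tensl|exact: lin_comp B_lin (lin_tensr T a)].
rewrite {1}/tree_coprod; congr (_ + _).
(* A child that is pruned whole leaves nothing in the trunk, hence the default 1. *)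
pose g c := tens T (\prod_(u <- c.1) tvar u) (oapp tvar 1 c.2).
have -> : \prod_(t <- ts) tree_coprod t = \sum_(ch <- prodseq (map child_cuts ts))
    \prod_(c <- ch) g c.
  rewrite sum_prodseq big_map; apply: eq_bigr => t _.
  by rewrite /child_cuts big_cons big_map {1}/g /= big_seq1.
rewrite (lin_sum _ _ _ (lin_bil T _)) cuts_node big_map; apply: eq_bigr => ch _ /=.
rewrite tens_prod bil_tens // -B_prod; congr (tens T _ (B _)).
  by rewrite big_flatten big_map.
by elim: ch => [|[a [u|]] ch IH] /=; rewrite ?big_nil ?big_cons //= IH ?mul1r.
Qed.

(** Cuts are listed in planar order, but the cocycle equation expresses the coproduct by a
    commutative product over the children, so it descends to isomorphism classes. *)
Lemma tree_coprod_canon t : tree_coprod (canon t) = tree_coprod t.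
Proof.
elim/rtree_ind': t => ts IH; rewrite /= !tree_coprod_node.
rewrite (perm_big _ (permEl (perm_sort tle _))) big_map.
have -> : tvar (RNode (sort tle (map canon ts))) = tvar (RNode ts).
  by rewrite -(tvar_canon (RNode ts)).
by congr (_ + bil T _ _); rewrite !big_seq; apply: eq_bigr => t /IH.
Qed.

Variable S : A -> A.
Hypothesis S_lin : lin S.
Hypothesis S1 : S 1 = 1.
Hypothesis SM : forall x y, S (x * y) = S x * S y.

Lemma antipode_sum t :
  bil T (fun a b => S a * b) (tree_coprod t - tens T (tvar t) 1) =
  tvar t + \sum_(pr <- cuts t | pr.1 != [::]) (\prod_(u <- pr.1) S (tvar u)) * tvar pr.2.
Proof.
have bS : bilin (fun a b => S a * b).
  by split=> [b|a]; [exact: lin_comp S_lin (lin_mulr b)|exact: lin_mull].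
rewrite /tree_coprod addrC addKr (lin_sum _ _ _ (lin_bil T _)).
rewrite (bigID (fun pr => pr.1 == [::])) /=; congr (_ + _).
  by rewrite -big_filter cuts_nil big_seq1 big_nil bil_tens // S1 mul1r.
apply: eq_bigr => pr _; rewrite bil_tens //; congr (_ * _).
exact: (big_morph S SM S1).
Qed.

Variable fuel : nat -> rtree -> A.
Hypothesis fuelS : forall n t, fuel n.+1 t =
  - tvar t - \sum_(pr <- cuts t | pr.1 != [::]) (\prod_(u <- pr.1) fuel n u) * tvar pr.2.
Hypothesis S_fuel : forall t, S (tvar t) = fuel (tsize (canon t)) (canon t).

(** The right-hand side does not involve the fuel and is unchanged by [canon]. By induction both
    [fuel n u] and [S (tvar u)], computed on the canonical tree with its own size as fuel, have this
    value for each pruned tree u, so they agree. *)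
Lemma fuel_coprod n t : (tsize t <= n)%N ->
  fuel n t = - bil T (fun a b => S a * b) (tree_coprod t - tens T (tvar t) 1).
Proof.
elim/ltn_ind: n t => -[|n] IH t; first by case: t.
move=> tn; rewrite antipode_sum fuelS opprD; congr (_ - _).
rewrite big_seq_cond [RHS]big_seq_cond; apply: eq_bigr => pr /andP[prt _].
congr (_ * _); rewrite !big_seq; apply: eq_bigr => u upr.
have un : (tsize u <= n)%N by rewrite -ltnS (leq_trans (cuts_size_lt prt upr)).
by rewrite S_fuel !IH ?tsize_canon // tree_coprod_canon tvar_canon.
Qed.
End TreeCoproduct.

(** * Isomorphism classes of rooted trees as an instance *)

Definition forest (m : {cmonom ctree}) : seq rtree :=
  flatten [seq nseq (m i) (val i) | i <- enum_fset (finsupp m)].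

Definition forest_mono (ts : seq rtree) : {cmonom ctree} :=
  foldr (fun t m => mulcm (ucm (cls t)) m) (onecm ctree) ts.

Definition root_forest (m : {cmonom ctree}) : ctree := cls (RNode (forest m)).

Definition vertices (i : ctree) : nat := tsize (val i).

Lemma count_forest m u :
  count_mem u (forest m) = wgt (fun i : ctree => nat_of_bool (val i == u)) m.
Proof.
rewrite /forest count_flatten sumnE 2!big_map /wgt; apply: eq_bigr => i _.
by rewrite count_nseq mulnC.
Qed.

Lemma perm_forest_mono ts : perm_eq (forest (forest_mono ts)) (map canon ts).
Proof.
apply/allP => u _ /=; rewrite count_forest; apply/eqP.
elim: ts => [|t ts IH]; first exact: wgt1.
by rewrite /= wgtM wgtU IH.
Qed.

Lemma root_forest_mono ts : root_forest (forest_mono ts) = cls (RNode ts).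
Proof.
apply: val_inj; rewrite !val_cls; apply: canon_perm.
have := perm_map canon (perm_forest_mono ts).
have cc : canon \o canon =1 canon by move=> t; exact: canon_idem.
by rewrite -map_comp (eq_map cc).
Qed.

Lemma root_forest_surj i : exists m, i = root_forest m.
Proof.
case E : (val i) => [ts]; exists (forest_mono ts).
by rewrite root_forest_mono -E cls_val.
Qed.

Lemma vertices_root_forest m : vertices (root_forest m) = (wgt vertices m).+1.
Proof.
rewrite /vertices val_cls tsize_canon /=; congr _.+1.
rewrite sumnE big_map big_flatten big_map; apply: eq_bigr => i _.
by rewrite big_nseq iter_addn_0 mulnC.
Qed.

Lemma prod_forest (R : comNzRingType) (f : rtree -> R) m :
  \prod_(t <- forest m) f t = monev (fun i : ctree => f (val i)) m.
Proof.
rewrite /forest big_flatten big_map; apply: eq_bigr => i _.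
by rewrite big_nseq iter_mulr_1.
Qed.

Lemma prod_tv ts : \prod_(t <- ts) tv t = << forest_mono ts >>.
Proof.
elim: ts => [|t ts IH]; first by rewrite big_nil.
rewrite big_cons IH; exact: esym (monoM _ _).
Qed.

Fixpoint rtree_rec (R : comNzRingType) (L : R -> R) (t : rtree) : R :=
  let: RNode ts := t in L (\prod_(x <- map (rtree_rec L) ts) x).

Lemma rtree_rec_canon (R : comNzRingType) (L : R -> R) t :
  rtree_rec L (canon t) = rtree_rec L t.
Proof.
elim/rtree_ind': t => ts IH /=; congr L.
rewrite !big_map (perm_big _ (permEl (perm_sort tle _))) big_map.
by rewrite !big_seq; apply: eq_bigr => u /IH.
Qed.

Definition ctree_rec (R : comNzRingType) (L : R -> R) (i : ctree) : R :=
  rtree_rec L (val i).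

Lemma ctree_recE (R : comNzRingType) (L : R -> R) m :
  ctree_rec L (root_forest m) = L (monev (ctree_rec L) m).
Proof.
rewrite /ctree_rec val_cls rtree_rec_canon /= big_map.
by rewrite prod_forest.
Qed.

Local Notation T := (poly_tensor ctree).
Local Notation Bplus := (grafting root_forest).

Lemma tv_canon t : tv (canon t) = tv t.
Proof. by rewrite /tv cls_canon. Qed.

Lemma grafting_prod_tv ts : Bplus (\prod_(t <- ts) tv t) = tv (RNode ts).
Proof. by rewrite prod_tv grafting_mono root_forest_mono. Qed.

Lemma tensE x y : Defs.tens x y = tens T x y.
Proof. by rewrite /= ptens.unlock injl.unlock injr.unlock. Qed.

Definition ctree_coprod (i : ctree) : HR2 := tree_coprod T tv (val i).

Lemma delta_treeE t : delta_tree t = tree_coprod T tv t.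
Proof.
rewrite /delta_tree /tree_coprod tensE; congr (_ + _).
by apply: eq_bigr => pr _; exact: tensE.
Qed.

Lemma DeltaE x : Delta x = subst ctree_coprod x.
Proof. by apply: eq_subst => i; exact: delta_treeE. Qed.

Lemma ctree_coprod_root m : ctree_coprod (root_forest m) =
  tens T (pvar (root_forest m)) 1 +
  bil T (fun a b => tens T a (Bplus b)) (monev ctree_coprod m).
Proof.
rewrite /ctree_coprod val_cls.
rewrite (tree_coprod_canon T (lin_grafting root_forest) grafting_prod_tv tv_canon).
rewrite (tree_coprod_node T (lin_grafting root_forest) grafting_prod_tv).
by rewrite prod_forest.
Qed.

Definition ctree_antip (i : ctree) : HR := antip_fuel (tsize (val i)) (val i).

Lemma ctree_antip_eq i : ctree_antip i =
  - bil T (fun a b => subst ctree_antip a * b) (ctree_coprod i - tens T (pvar i) 1).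
Proof.
have Ei : tv (val i) = pvar i by rewrite /tv cls_val.
have antipS n t : antip_fuel n.+1 t = - tv t - \sum_(pr <- cuts t | pr.1 != [::])
    (\prod_(u <- pr.1) antip_fuel n u) * tv pr.2 by [].
have antipE t : subst ctree_antip (tv t) = antip_fuel (tsize (canon t)) (canon t).
  exact: subst_var.
rewrite -Ei; exact: (fuel_coprod T (lin_grafting root_forest) grafting_prod_tv tv_canon
  (lin_subst ctree_antip) (subst1 ctree_antip) (substM ctree_antip) antipS antipE
  (leqnn _)).
Qed.

Lemma tensmapE f g z : tensmap f g z = bil T (fun a b => tens T (f a) (g b)) z.
Proof. by apply: eq_bigr => m _; rewrite tensE. Qed.

Lemma PrimP x : reflect (primitive T (subst ctree_coprod) x) (Prim x).
Proof. by apply: (iffP eqP); rewrite DeltaE !tensE. Qed.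

Lemma bialg_autP f : bialg_aut f <-> tree_bialg ctree_coprod f.
Proof.
have E x : Delta (f x) = tensmap f f (Delta x) <->
    subst ctree_coprod (f x) =
    bil T (fun a b => tens T (f a) (f b)) (subst ctree_coprod x).
  by rewrite -(tensmapE f f (subst ctree_coprod x)) -(DeltaE x) -(DeltaE (f x)).
split=> -[Lf bf mf Df ef].
  by split; [exact Lf|exact bf|exact mf|move=> x; exact (proj1 (E x) (Df x))|exact ef].
by split; [exact Lf|exact bf|exact mf|move=> x; exact (proj2 (E x) (Df x))|exact ef].
Qed.

Lemma GLPrimP g : GLPrim g <-> tree_GL ctree_coprod g.
Proof.
split=> -[gl gp gi gs]; split.
- by move=> a x y /PrimP Px /PrimP Py; exact: gl.
- by move=> x /PrimP /gp /PrimP.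
- by move=> x y /PrimP Px /PrimP Py; exact: gi.
- by move=> y /PrimP /gs [x /PrimP Px gx]; exists x.
- by move=> a x y /PrimP Px /PrimP Py; exact: gl.
- by move=> x /PrimP /gp /PrimP.
- by move=> x y /PrimP Px /PrimP Py; exact: gi.
- by move=> y /PrimP /gs [x /PrimP Px gx]; exists x.
Qed.

Theorem theorem12p5 :
  (* Aut_bialgebra(H_R) = Aut_Hopf(H_R) *)
  (forall Phi : HR -> HR, bialg_aut Phi <-> hopf_aut Phi) /\
  (* chi : Phi |-> Phi|_Prim is well defined with values in GL(Prim(H_R)) *)
  (forall Phi : HR -> HR, bialg_aut Phi -> GLPrim Phi) /\
  (* chi has a group-morphism section s : GL(Prim) -> Aut, hence
     Aut = Ker(chi) x| s(GL(Prim)) with s(GL(Prim)) ~ GL(Prim) *)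
  (exists s : (HR -> HR) -> (HR -> HR),
    [/\ (forall g, GLPrim g -> bialg_aut (s g)),
        (forall g, GLPrim g -> forall x, Prim x -> s g x = g x),
        (forall g g', GLPrim g -> (forall x, Prim x -> g x = g' x) -> s g =1 s g') &
        (forall g h, GLPrim g -> GLPrim h -> s (g \o h) =1 s g \o s h)]).
Proof.
have [antipS [GLS [secB secP secE secC]]] := tree_semidirect root_forest_surj
  vertices_root_forest ctree_coprod_root ctree_antip_eq ctree_recE.
split; last split.
- move=> Phi; split; last by case.
  move=> bPhi; split; first exact bPhi.
  exact (antipS Phi (proj1 (bialg_autP Phi) bPhi)).
- move=> Phi bPhi; exact (proj2 (GLPrimP Phi) (GLS Phi (proj1 (bialg_autP Phi) bPhi))).
exists (tree_section root_forest vertices ctree_coprod ctree_antip ctree_rec); split.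
- move=> g /GLPrimP Gg; exact (proj2 (bialg_autP _) (secB g Gg)).
- move=> g /GLPrimP Gg x /PrimP Px; exact (secP g Gg x Px).
- move=> g g' /GLPrimP Gg E; apply: (secE g g' Gg) => x Px.
  exact (E x (introT (PrimP x) Px)).
- move=> g h /GLPrimP Gg /GLPrimP Gh; exact (secC g h Gg Gh).
Qed.
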